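(* Let $\rho>0$, $\mathbf{u}$, $\phi$ be smooth on a space-time domain $\Omega\times[t_0,t_1]$, $\Omega\subset\mathbb{R}^d$, and satisfy mass conservation $\partial_t\rho+\mathrm{div}(\rho\mathbf{u})=0$. Consider the action $$a=\int_{t_0}^{t_1}\!\!\int_{\Omega} L\,d\Omega\,dt,\qquad L=\tfrac12\rho\|\mathbf{u}\|^2-\tfrac12\alpha(\rho)\|\nabla\phi\|^2-\rho\,\varepsilon^\star(\rho,\dot\phi),\qquad \dot\phi=\partial_t\phi+\mathbf{u}\cdot\nabla\phi .$$ Suppose that (a) $a$ is stationary with respect to all variations of $\phi$ vanishing on the boundary of $\Omega\times[t_0,t_1]$ (with $\rho,\mathbf{u}$ fixed), and (b) $a$ is stationary with respect to all variations of the motion, i.e. for every smooth virtual displacement $\boldsymbol{\zeta}(t,\mathbf{x})\in\mathbb{R}^d$ vanishing on the boundary of $\Omega\times[t_0,t_1]$, the first variation of $a$ vanishes for the Eulerian variations $\delta\rho=-\mathrm{div}(\rho\boldsymbol{\zeta})$, $\delta\mathbf{u}=\partial_t\boldsymbol{\zeta}+\frac{\partial\boldsymbol{\zeta}}{\partial\mathbf{x}}\mathbf{u}-\frac{\partial\mathbf{u}}{\partial\mathbf{x}}\boldsymbol{\zeta}$, with $\phi$ fixed as a function of $(\mathbf{x},t)$. Then, with $\eta=\frac{\partial\varepsilon^\star}{\partial\dot\phi}(\rho,\dot\phi)$, the following equations hold: $$\partial_t(\rho\eta)+\mathrm{div}\big(\rho\eta\,\mathbf{u}+\alpha(\rho)\nabla\phi\big)=0,$$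 $$\partial_t(\rho\mathbf{u})+\mathrm{div}\Big(\rho\,\mathbf{u}\otimes\mathbf{u}+\Big(\rho^2\frac{\partial\varepsilon^\star}{\partial\rho}+\tfrac12\big(\rho\alpha'(\rho)-\alpha(\rho)\big)\|\nabla\phi\|^2\Big)\mathbf{I}+\alpha(\rho)\,\nabla\phi\otimes\nabla\phi\Big)=0 .$$
   Context: $\alpha:(0,\infty)\to(0,\infty)$ and $\varepsilon^\star(\rho,\dot\phi)$ are given smooth functions. $\varepsilon^\star$ is the Helmholtz free energy; it is related to the internal energy by $\varepsilon(\rho,\eta)=\varepsilon^\star(\rho,\dot\phi)-\eta\dot\phi$, so that $\partial\varepsilon/\partial\rho=\partial\varepsilon^\star/\partial\rho$. The matrix $\frac{\partial\mathbf{u}}{\partial\mathbf{x}}$ is the Jacobian with entries $\partial u_i/\partial x_j$. The divergence of a second order tensor $\mathbf{A}$ is the vector defined by $\mathrm{div}(\mathbf{A})\cdot\mathbf{a}=\mathrm{div}(\mathbf{A}\mathbf{a})$ for all constant vectors $\mathbf{a}$ (i.e. the divergence of each column). *)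

(* Defs.v *)
From HB Require Import structures.
From mathcomp Require Import all_boot all_order all_algebra.
From mathcomp Require Import all_classical all_reals all_analysis.

Set Implicit Arguments.
Unset Strict Implicit.
Unset Printing Implicit Defensive.

Import Order.TTheory GRing.Theory Num.Theory.
Import numFieldNormedType.Exports.

Local Open Scope classical_set_scope.
Local Open Scope ring_scope.

(** Lebesgue measure on [R^n], carried by ['rV[R]_n] with the sigma-algebra
    generated by the coordinates. *)

Fact rV_display : measure_display. Proof. exact: default_measure_display. Qed.

Section measurable_rV.
Context {R : realType} {n : nat}.

Definition rV_coord (i : 'I_n) (v : 'rV[R]_n) : R := v ord0 i.

Let rV_set0 : g_sigma_preimage rV_coord set0.
Proof. exact: sigma_algebra0. Qed.

Let rV_setC A : g_sigma_preimage rV_coord A -> g_sigma_preimage rV_coord (~` A).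
Proof. exact: sigma_algebraC. Qed.

Let rV_bigcup (F : (set 'rV[R]_n)^nat) :
  (forall i, g_sigma_preimage rV_coord (F i)) ->
  g_sigma_preimage rV_coord (\bigcup_i (F i)).
Proof. exact: sigma_algebra_bigcup. Qed.

HB.instance Definition _ := @isMeasurable.Build rV_display
  'rV[R]_n (g_sigma_preimage rV_coord) rV_set0 rV_setC rV_bigcup.

End measurable_rV.

Section lebesgue_rV.
Context {R : realType}.

Lemma measurable_rV_coord n (i : 'I_n) :
  measurable_fun [set: 'rV[R]_n] (rV_coord i).
Proof.
move=> _ Y mY; rewrite setTI; apply: sub_sigma_algebra => /=.
rewrite -bigcup_seq/=; exists i => /=; first by rewrite mem_index_enum.
by exists Y => //; rewrite setTI.
Qed.

Lemma measurable_fun_rV d (T : measurableType d) n (f : T -> 'rV[R]_n) :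
  (forall i, measurable_fun [set: T] (fun x => f x ord0 i)) ->
  measurable_fun [set: T] f.
Proof.
move=> mf.
pose G := \big[setU/set0]_(i < n)
  preimage_set_system setT (@rV_coord R n i) measurable.
have := @measurability _ _ T 'rV[R]_n setT f G erefl; apply.
move=> _ [B + <-]; rewrite /G -bigcup_seq => -[i _ [A mA <-]].
rewrite !setTI -comp_preimage.
by have := mf i measurableT _ mA; rewrite setTI.
Qed.

Definition rV_cons n (p : R * 'rV[R]_n) : 'rV[R]_n.+1 :=
  row_mx (p.1)%:M p.2 : 'rV_(1 + n).

Definition rV_uncons n (v : 'rV[R]_n.+1) : R * 'rV[R]_n :=
  (v ord0 ord0, \row_j v ord0 (lift ord0 j)).

Lemma rV_cons0 n (p : R * 'rV[R]_n) : rV_cons p ord0 ord0 = p.1.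
Proof.
rewrite /rV_cons mxE; case: splitP => [j _|j] /=; last by [].
by rewrite mxE (ord1 j) eqxx.
Qed.

Lemma rV_consS n (p : R * 'rV[R]_n) j :
  rV_cons p ord0 (lift ord0 j) = p.2 ord0 j.
Proof.
rewrite /rV_cons mxE; case: splitP => k /=; first by rewrite (ord1 k).
by rewrite /bump /= !add1n => -[jk]; congr (p.2 _ _); exact/val_inj.
Qed.

Lemma rV_consK n : cancel (@rV_cons n) (@rV_uncons n).
Proof.
move=> [x v]; rewrite /rV_uncons rV_cons0; congr pair.
by apply/rowP => j; rewrite mxE rV_consS.
Qed.

Lemma measurable_rV_cons n : measurable_fun [set: R * 'rV[R]_n] (@rV_cons n).
Proof.
apply: measurable_fun_rV => i; case: (unliftP ord0 i) => [j ->|->].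
  rewrite (_ : (fun _ => _) = rV_coord j \o snd); last first.
    by apply/funext => p; rewrite rV_consS.
  exact: (measurableT_comp (measurable_rV_coord j) measurable_snd).
rewrite (_ : (fun _ => _) = fst); first exact: measurable_fst.
by apply/funext => p; rewrite rV_cons0.
Qed.

Lemma measurable_rV_uncons n : measurable_fun [set: 'rV[R]_n.+1] (@rV_uncons n).
Proof.
apply: measurable_fun_pair; first exact: (measurable_rV_coord ord0).
apply: measurable_fun_rV => i; under eq_fun do rewrite mxE.
exact: (measurable_rV_coord (lift ord0 i)).
Qed.

Section lebesgue_rV_step.
Local Open Scope ereal_scope.
Variables (n : nat) (mu : {sigma_finite_measure set 'rV[R]_n -> \bar R}).

Definition rV_step : set 'rV[R]_n.+1 -> \bar R :=
  pushforward (@lebesgue_measure R \x mu) (@rV_cons n).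

Let mcons := @measurable_rV_cons n.

Let step0 : rV_step set0 = 0.
Proof. by rewrite /rV_step /pushforward preimage_set0 measure0. Qed.

Let step_ge0 A : 0 <= rV_step A.
Proof. exact: measure_ge0. Qed.

Let step_sigma_additive : semi_sigma_additive rV_step.
Proof.
exact: (@measure_semi_sigma_additive _ _ _
  (measure_function_pushforward__canonical__measure_function_Measure
     (@lebesgue_measure R \x mu) mcons)).
Qed.

HB.instance Definition _ := isMeasure.Build _ _ _ rV_step
  step0 step_ge0 step_sigma_additive.

Let step_sigma_finite : sigma_finite setT rV_step.
Proof.
have /sigma_finiteP[F [FT ndF Foo]] := sigma_finiteT (@lebesgue_measure R).
have /sigma_finiteP[G [GT ndG Goo]] := sigma_finiteT mu.
exists (fun i => @rV_uncons n @^-1` (F i `*` G i)).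
  rewrite -preimage_bigcup (_ : \bigcup_i (F i `*` G i) = setT) ?preimage_setT//.
  rewrite -subTset => -[x v] _.
  have [i _ Fx] : (\bigcup_i F i) x by rewrite -FT.
  have [j _ Gv] : (\bigcup_i G i) v by rewrite -GT.
  exists (maxn i j) => //; split.
    by move: x Fx; exact/subsetPset/ndF/leq_maxl.
  by move: v Gv; exact/subsetPset/ndG/leq_maxr.
move=> i; have [mF Fi] := Foo i; have [mG Gi] := Goo i; split.
  rewrite -[_ @^-1` _]setTI; apply: measurable_rV_uncons => //.
  exact: measurableX.
rewrite /rV_step /pushforward -comp_preimage.
rewrite (_ : _ \o _ = id); last by apply/funext => p /=; rewrite rV_consK.
by rewrite preimage_id product_measure1E// lte_mul_pinfty// ge0_fin_numE.
Qed.

HB.instance Definition _ := Measure_isSigmaFinite.Build _ _ _ rV_step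
  step_sigma_finite.

End lebesgue_rV_step.

Fixpoint lebesgue_rV n : {sigma_finite_measure set 'rV[R]_n -> \bar R} :=
  if n is m.+1 then rV_step (lebesgue_rV m) else dirac (0 : 'rV[R]_0).

Lemma lebesgue_rV_box n (A : 'I_n -> set R) :
  (forall i, measurable (A i)) ->
  (lebesgue_rV n [set v : 'rV[R]_n | forall i, A i (v ord0 i)] =
   \prod_(i < n) lebesgue_measure (A i))%E.
Proof.
elim: n A => [|n IH] A mA.
  by rewrite big_ord0 /= diracE mem_set//= => -[].
pose B := [set v : 'rV[R]_n | forall i, A (lift ord0 i) (v ord0 i)].
have mB : measurable B.
  rewrite (_ : B = \bigcap_(i in [set: 'I_n])
      (@rV_coord R n i @^-1` A (lift ord0 i))).
    apply: fin_bigcap_measurable => // i _; rewrite -[_ @^-1` _]setTI.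
    exact: measurable_rV_coord.
  by apply/seteqP; split => v Bv i; [move=> _|]; exact: Bv.
have AE : @rV_cons n @^-1` [set v : 'rV[R]_n.+1 | forall i, A i (v ord0 i)]
    = A ord0 `*` B.
  apply/seteqP; split => p /=.
    by move=> Ap; split => [|i]; [rewrite -rV_cons0|rewrite -rV_consS]; exact: Ap.
  by move=> [A0 AS] i; case: (unliftP ord0 i) => [j ->|->];
    rewrite ?rV_consS ?rV_cons0//; exact: AS.
rewrite big_ord_recl -IH; last by move=> i; exact: mA.
rewrite [LHS]/(rV_step (lebesgue_rV n) _) /rV_step /pushforward AE.
by have -> := product_measure1E (@lebesgue_measure R) (lebesgue_rV n)
  (mA ord0) mB.
Qed.

End lebesgue_rV.

(** [C^k] on an open set [U] of a finite-dimensional [V]: all iterated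
    directional derivatives up to order [k] exist and are continuous on [U].
    The value of ['D_v f] at a point of the open set [U] only depends on the
    restriction of [f] to [U]. *)
Section smooth.
Context {R : realType} {V W : normedModType R}.

Fixpoint Ck (k : nat) (U : set V) (f : V -> W) : Prop :=
  if k is m.+1 then
    (forall x, U x -> differentiable f x) /\ (forall v, Ck m U ('D_v f))
  else forall x, U x -> {for x, continuous f}.

(** Smooth up to the boundary when [A] contains part of its boundary: the total
    function [f] is smooth on some open neighbourhood of [A], so that the
    two-sided derivatives used below are the derivatives of [f] on [A]. *)
Definition smooth_on (A : set V) (f : V -> W) : Prop :=
  exists U : set V, [/\ open U, A `<=` U & forall k, Ck k U f].

End smooth.

(** Space-time points are pairs [(t, x)]. Vectors of [R^d] are rows, and a
    second order tensor acts on a vector through its entries [A i j] in the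
    usual column convention, so that [A v] is the row [v *m A^T]. *)
Section fields.
Context {R : realType} {d : nat}.
Local Notation spacetime := (R * 'rV[R]_d)%type.
Implicit Types (f : spacetime -> R) (v : spacetime -> 'rV[R]_d).

Definition dt f (p : spacetime) : R := 'D_((1, 0) : spacetime) f p.

Definition dx (i : 'I_d) f (p : spacetime) : R :=
  'D_((0, delta_mx ord0 i) : spacetime) f p.

Definition dtv v (p : spacetime) : 'rV[R]_d :=
  \row_i dt (fun q => v q ord0 i) p.

Definition grad f (p : spacetime) : 'rV[R]_d := \row_i dx i f p.

Definition div v (p : spacetime) : R := \sum_i dx i (fun q => v q ord0 i) p.

(** Entries [d v_i / d x_j]; the transpose of the library's [jacobian]. *)
Definition jac v (p : spacetime) : 'M[R]_d :=
  \matrix_(i, j) dx j (fun q => v q ord0 i) p.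

(** [div A . a = div (A a)] for constant [a], i.e. the divergence of each
    column. *)
Definition divT (A : spacetime -> 'M[R]_d) (p : spacetime) : 'rV[R]_d :=
  \row_j div (fun q => \row_i A q i j) p.

(** The library's norm on ['rV[R]_d] is the sup norm, whence [dotv v v] for
    the square of the Euclidean norm. *)
Definition dotv (a b : 'rV[R]_d) : R := \sum_i a ord0 i * b ord0 i.

Definition tens (a b : 'rV[R]_d) : 'M[R]_d := \matrix_(i, j) (a ord0 i * b ord0 j).

Definition material_dt (u : spacetime -> 'rV[R]_d) f (p : spacetime) : R :=
  dt f p + dotv (u p) (grad f p).

Definition lagrangian (alpha : R -> R) (eps : R * R -> R)
    (rho : spacetime -> R) (u : spacetime -> 'rV[R]_d) (phi : spacetime -> R)
    (p : spacetime) : R :=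
  2^-1 * rho p * dotv (u p) (u p)
  - 2^-1 * alpha (rho p) * dotv (grad phi p) (grad phi p)
  - rho p * eps (rho p, material_dt u phi p).

Definition cylinder (Omega : set 'rV[R]_d) (t0 t1 : R) : set spacetime :=
  `[t0, t1] `*` Omega.

Definition lebesgue_spacetime :
    {measure set (measurableTypeR R * 'rV[R]_d) -> \bar R} :=
  (@lebesgue_measure R \x lebesgue_rV d)%E.

Definition action (alpha : R -> R) (eps : R * R -> R)
    (Omega : set 'rV[R]_d) (t0 t1 : R)
    (rho : spacetime -> R) (u : spacetime -> 'rV[R]_d) (phi : spacetime -> R) :
    R :=
  (\int[lebesgue_spacetime]_(p in cylinder Omega t0 t1)
     lagrangian alpha eps rho u phi p)%R.

(** Smooth variations on the closed cylinder vanishing on its boundary. When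
    [Omega] is unbounded they are moreover required to vanish far away; this
    is automatic when [Omega] is bounded. *)
Definition admissible_variation {W : normedModType R} (D : set spacetime)
    (f : spacetime -> W) : Prop :=
  [/\ smooth_on (closure D) f,
      forall p, (closure D `\` D°) p -> f p = 0 &
      bounded_set (closure D `&` [set p | f p != 0])].

(** Vanishing first variation: [F s] is the action of the fields perturbed by
    [s] times the given variation. *)
Definition stationary (F : R -> R) : Prop := is_derive (0 : R) 1 F 0.

Definition delta_rho (rho : spacetime -> R) (zeta : spacetime -> 'rV[R]_d)
    (p : spacetime) : R :=
  - div (fun q => rho q *: zeta q) p.

Definition delta_u (u zeta : spacetime -> 'rV[R]_d) (p : spacetime) :
    'rV[R]_d :=
  dtv zeta p + u p *m (jac zeta p)^T - zeta p *m (jac u p)^T.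

End fields.

(* Main.v *)
Require Import Defs.
From HB Require Import structures.
From mathcomp Require Import all_boot all_order all_algebra.
From mathcomp Require Import all_classical all_reals all_analysis.
From mathcomp Require Import measurable_realfun.
From mathcomp Require Import ring lra.

Set Implicit Arguments.
Unset Strict Implicit.
Unset Printing Implicit Defensive.

Import Order.TTheory GRing.Theory Num.Theory.
Import numFieldNormedType.Exports.

Local Open Scope classical_set_scope.
Local Open Scope ring_scope.

(** The theorem is the principle of stationary action, carried out with test
    functions of compact support.

    Let [psi] be a smooth bump supported in a small box inside the cylinder.
    Varying [phi] along [psi], or the motion along [psi] times a basis vector,
    changes the Lagrangian only on that box, so the action can be differentiated
    under the integral sign by dominated convergence ([first_variation]). Both
    variations act linearly on the values of the fields at each point, and one
    formula for the derivative of the Lagrangian serves both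
    ([jet_first_variation]). Stationarity then says that the integral of
    [A * psi + B0 * dt psi + sum_i B i * dx i psi] vanishes for every such bump.
    Since a derivative of a compactly supported function has integral zero
    ([integral_derive_eq0], by Fubini's theorem and the fundamental theorem of
    calculus), the fundamental lemma of the calculus of variations
    ([weak_to_strong]) gives [A = dt B0 + sum_i dx i (B i)] at interior points.

    The variations of [phi] give the balance of entropy as it stands
    ([euler_lagrange_phi]). The variations of the motion give, with
    [m = rho (u - eta grad phi)] and [ell] the derivative of the Lagrangian in
    [rho], the equation
    [dt m + div (u (x) m) + (du/dx)^T m = rho grad ell]
    ([euler_lagrange_motion]). Expanding [grad ell], eliminating the derivatives
    of [rho eta] by the balance of entropy and exchanging second derivatives of
    [phi] ([derive_comm]) turn it into the balance of momentum
    ([momentum_from_euler_lagrange]).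

    Both left-hand sides are continuous on a neighbourhood of the cylinder, so
    the equations extend from the interior to the initial and final times
    ([zero_on_cylinder]). *)

(** * Differentiation rules *)

Section derivation_rules.
Context {R : realType}.
Implicit Types V W : normedModType R.

Lemma open_near V (U : set V) (P : V -> Prop) x : open U -> U x ->
  (forall y, U y -> P y) -> \near x, P x.
Proof.
by move=> oU Ux UP; near=> y; apply: UP; near: y; exact: open_nbhs_nbhs.
Unshelve. all: by end_near. Qed.

Lemma near0_differentiable V W (e : V -> W) x :
  (\near x, e x = 0) -> differentiable e x.
Proof.
move=> e0.
have De : e \o shift x = cst (e x) + (\0 : V -> W) +o_ 0 id.
  apply/eqaddoP => r r0.
  rewrite (nbhs_singleton e0) near_simpl.
  move: e0; rewrite (near_shift 0) subr0 => e0.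
  near=> y; rewrite !fctE/= addr0 subr0.
  have -> : e (y + x) = 0 by near: y.
  by rewrite normr0 mulr_ge0// ltW.
have c0 : continuous (\0 : V -> W) by exact: cst_continuous.
apply/diff_locallyP; split; first by rewrite (diff_unique c0 De).
by rewrite (diff_unique c0 De).
Unshelve. all: by end_near. Qed.

(** Differentiability is local: write [g = f + (g - f)], where the difference
    vanishes near [x]. *)
Lemma near_eq_differentiable V W (f g : V -> W) x :
  (\near x, f x = g x) -> differentiable f x -> differentiable g x.
Proof.
move=> fg df; rewrite (_ : g = f + (g - f)); last first.
  by apply/funext => y; rewrite !fctE/= addrC subrK.
apply: (@differentiableD _ _ _ f (g - f)) df _; apply: near0_differentiable.
by near=> y; rewrite !fctE/= (_ : f y = g y) ?subrr//; near: y.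
Unshelve. all: by end_near. Qed.

Lemma pair_scaleE (a b : R) : (a, b) = a *: (1, 0) + b *: (0, 1) :> R * R.
Proof.
apply/pair_equal_spec; split; rewrite /= /GRing.scale/=;
  by rewrite ?mulr0 ?mulr1 ?addr0 ?add0r.
Qed.

Lemma D_comp1 V W (g : R -> W) (f : V -> R) v x :
  differentiable f x -> differentiable g (f x) ->
  'D_v (fun y => g (f y)) x = 'D_v f x *: 'D_1 g (f x).
Proof.
move=> df dg; rewrite !deriveE//; last exact: differentiable_comp.
by rewrite diff_comp//= -linearZ/= [in RHS]/GRing.scale/= mulr1.
Qed.

(** A direction of [R * R] is a combination of the two axes, so the partial
    derivatives of [g] suffice for its chain rule. *)
Lemma D_comp2 V W (g : R * R -> W) (a b : V -> R) v x :
  differentiable a x -> differentiable b x -> differentiable g (a x, b x) ->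
  'D_v (fun y => g (a y, b y)) x =
  'D_v a x *: 'D_(1, 0) g (a x, b x) + 'D_v b x *: 'D_(0, 1) g (a x, b x).
Proof.
move=> da db dg.
have dab : differentiable (fun y => (a y, b y)) x by exact: differentiable_pair.
rewrite !deriveE//; last exact: differentiable_comp.
rewrite (@diff_comp _ _ _ _ (fun y => (a y, b y)) g)//= diff_pair//=.
set L := 'd g _.
have -> : ('d a x v, 'd b x v) =
    'd a x v *: (1, 0) + 'd b x v *: (0, 1) :> R * R.
  exact: pair_scaleE.
by rewrite (linearD L) !(linearZ_LR L).
Qed.

Lemma D_add V W (f g : V -> W) v x :
  differentiable f x -> differentiable g x ->
  'D_v (fun y => f y + g y) x = 'D_v f x + 'D_v g x.
Proof. by move=> df dg; apply: deriveD; exact: diff_derivable. Qed.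

Lemma D_sub V W (f g : V -> W) v x :
  differentiable f x -> differentiable g x ->
  'D_v (fun y => f y - g y) x = 'D_v f x - 'D_v g x.
Proof. by move=> df dg; apply: deriveB; exact: diff_derivable. Qed.

Lemma D_opp V W (f : V -> W) v x :
  differentiable f x -> 'D_v (fun y => - f y) x = - 'D_v f x.
Proof. by move=> df; apply: deriveN; exact: diff_derivable. Qed.

Lemma D_mul V (f g : V -> R) v x :
  differentiable f x -> differentiable g x ->
  'D_v (fun y => f y * g y) x = 'D_v f x * g x + f x * 'D_v g x.
Proof.
move=> df dg; rewrite [LHS]deriveM; [|exact: diff_derivable..].
by rewrite addrC mulrC.
Qed.

Lemma D_cmul V (f : V -> R) c v x :
  differentiable f x -> 'D_v (fun y => c * f y) x = c * 'D_v f x.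
Proof. by move=> df; rewrite D_mul ?derive_cst ?mul0r ?add0r. Qed.

Lemma D_sum V W n (f : 'I_n -> V -> W) v x :
  (forall i, differentiable (f i) x) ->
  'D_v (fun y => \sum_i f i y) x = \sum_i 'D_v (f i) x.
Proof.
move=> df; rewrite (_ : (fun y => _) = \sum_i f i).
  by rewrite derive_sum// => i; exact: diff_derivable.
by apply/funext => y; rewrite fct_sumE.
Qed.

Lemma D_coord V m n (M : V -> 'M[R]_(m, n)) i j v x : differentiable M x ->
  'D_v (fun y => M y i j) x = 'D_v M x i j.
Proof. by move=> dM; rewrite derive_mx ?mxE//; exact: diff_derivable. Qed.

End derivation_rules.

Section has_D.
Context {R : realType} {V : normedModType R}.
Implicit Types (f g : V -> R) (x v : V).

(** Differentiability travels with the value of the derivative, so that a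
    derivative is computed by composing the rules below. *)
Definition has_D f x v (a : R) := differentiable f x /\ 'D_v f x = a.

Lemma has_DP f x v : differentiable f x -> has_D f x v ('D_v f x).
Proof. by []. Qed.

Lemma has_D_cst (c : R) x v : has_D (fun=> c) x v 0.
Proof. by split; [exact: differentiable_cst|exact: derive_cst]. Qed.

Lemma has_D_add f g x v a b : has_D f x v a -> has_D g x v b ->
  has_D (fun y => f y + g y) x v (a + b).
Proof. by move=> [df <-] [dg <-]; split; [exact: differentiableD|rewrite D_add]. Qed.

Lemma has_D_sub f g x v a b : has_D f x v a -> has_D g x v b ->
  has_D (fun y => f y - g y) x v (a - b).
Proof. by move=> [df <-] [dg <-]; split; [exact: differentiableB|rewrite D_sub]. Qed.

Lemma has_D_mul f g x v a b : has_D f x v a -> has_D g x v b ->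
  has_D (fun y => f y * g y) x v (a * g x + f x * b).
Proof. by move=> [df <-] [dg <-]; split; [exact: differentiableM|rewrite D_mul]. Qed.

Lemma has_D_cmul f x v (c : R) a : has_D f x v a ->
  has_D (fun y => c * f y) x v (c * a).
Proof.
move=> fa; have := has_D_mul (has_D_cst c x v) fa.
by rewrite mul0r add0r.
Qed.

Lemma has_D_sum n (f : 'I_n -> V -> R) x v (a : 'I_n -> R) :
  (forall i, has_D (f i) x v (a i)) ->
  has_D (fun y => \sum_i f i y) x v (\sum_i a i).
Proof.
move=> fa; split; last first.
  by rewrite D_sum => [|i]; [apply: eq_bigr => i _|]; have [] := fa i.
rewrite (_ : (fun y => _) = \sum_i f i).
  by apply: differentiable_sum => i; have [] := fa i.
by apply/funext => y; rewrite fct_sumE.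
Qed.

Lemma has_D_comp1 (h : R -> R) f x v a : has_D f x v a ->
  differentiable h (f x) -> has_D (fun y => h (f y)) x v (a * 'D_1 h (f x)).
Proof.
move=> [df <-] dh; split; last exact: D_comp1.
exact: (@differentiable_comp _ _ _ _ f h).
Qed.

Lemma has_D_comp2 (h : R * R -> R) f g x v a b :
  has_D f x v a -> has_D g x v b -> differentiable h (f x, g x) ->
  has_D (fun y => h (f y, g y)) x v
    (a * 'D_(1, 0) h (f x, g x) + b * 'D_(0, 1) h (f x, g x)).
Proof.
move=> [df <-] [dg <-] dh; split; last exact: D_comp2.
apply: (@differentiable_comp _ _ _ _ (fun y => (f y, g y)) h) => //.
exact: differentiable_pair.
Qed.

End has_D.

(** * Smooth functions *)

Section Ck_theory.
Context {R : realType}.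
Implicit Types V W : normedModType R.

Lemma Ck_eq V W k (U : set V) (f g : V -> W) : open U ->
  (forall x, U x -> f x = g x) -> Ck k U f -> Ck k U g.
Proof.
move=> oU; elim: k f g => [|k IH] f g fg /=.
  move=> Cf x Ux; rewrite /prop_for /continuous_at -(fg _ Ux).
  apply: cvg_trans (Cf x Ux); apply: near_eq_cvg.
  by apply: (open_near oU Ux) => y Uy; rewrite fg.
move=> [df Cf]; split=> [x Ux|v].
  apply: near_eq_differentiable (df x Ux).
  exact: (open_near oU Ux).
apply: IH (Cf v) => x Ux; apply: near_eq_derive.
exact: (open_near oU Ux).
Qed.

Lemma Ck_subset V W k (U U' : set V) (f : V -> W) :
  U' `<=` U -> Ck k U f -> Ck k U' f.
Proof.
move=> U'U; elim: k f => [|k IH] f /=; first by move=> Cf x /U'U/Cf.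
by move=> [df Cf]; split=> [x /U'U/df|v]//; exact/IH/Cf.
Qed.

(** Being [Ck] is local; this is what extends a compactly supported product by
    zero outside the domain of one of its factors. *)
Lemma Ck_setU V W k (U U' : set V) (f : V -> W) :
  Ck k U f -> Ck k U' f -> Ck k (U `|` U') f.
Proof.
elim: k f => [|k IH] f /=; first by move=> Cf Cf' x [/Cf|/Cf'].
by move=> [df Cf] [df' Cf']; split=> [x [/df|/df']|v]//; exact: IH.
Qed.

Lemma CkW V W k (U : set V) (f : V -> W) : Ck k.+1 U f -> Ck k U f.
Proof.
elim: k f => [|k IH] f /=.
  by move=> [df _] x /df/differentiable_continuous.
by move=> [df Cf]; split=> // v; apply: IH; exact: Cf.
Qed.

Lemma Ck_cst V W k (U : set V) (c : W) : Ck k U (cst c).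
Proof.
elim: k c => [|k IH] c /=; first by move=> x _; exact: cst_continuous.
split=> // v; rewrite (_ : 'D_v _ = cst 0)//.
by apply/funext => x; exact: derive_cst.
Qed.

Lemma Ck_add V W k (U : set V) (f g : V -> W) : open U ->
  Ck k U f -> Ck k U g -> Ck k U (fun x => f x + g x).
Proof.
move=> oU; elim: k f g => [|k IH] f g /=.
  by move=> Cf Cg x Ux; apply: cvgD; [exact: Cf|exact: Cg].
move=> [df Cf] [dg Cg]; split=> [x Ux|v].
  by apply: differentiableD; [exact: df|exact: dg].
apply: (Ck_eq oU _ (IH _ _ (Cf v) (Cg v))) => x Ux.
by rewrite D_add//; [exact: df|exact: dg].
Qed.

(** In Leibniz's rule one factor is differentiated and the other keeps its order,
    hence the appeal to [CkW] in the induction. *)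
Lemma Ck_mul V k (U : set V) (f g : V -> R) : open U ->
  Ck k U f -> Ck k U g -> Ck k U (fun x => f x * g x).
Proof.
move=> oU; elim: k f g => [|k IH] f g.
  by move=> /= Cf Cg x Ux; apply: cvgM; [exact: Cf|exact: Cg].
move=> Cf Cg; have [df Df] := Cf; have [dg Dg] := Cg; split=> [x Ux|v].
  by apply: differentiableM; [exact: df|exact: dg].
apply: (Ck_eq oU _ (Ck_add oU (IH _ _ (Df v) (CkW Cg))
  (IH _ _ (CkW Cf) (Dg v)))) => x Ux.
by rewrite D_mul//; [exact: df|exact: dg].
Qed.

Lemma Ck_scalel V W k (U : set V) (f : V -> R) (w : W) : open U ->
  Ck k U f -> Ck k U (fun x => f x *: w).
Proof.
move=> oU; elim: k f => [|k IH] f /=.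
  by move=> Cf x Ux; apply: cvgZr_tmp; exact: Cf.
move=> [df Cf]; split=> [x Ux|v]; first exact/differentiableZl/df.
apply: (Ck_eq oU _ (IH _ (Cf v))) => x Ux.
have dfx : differentiable f x by exact: df.
rewrite deriveE// [in RHS]deriveE; last exact: differentiableZl.
by rewrite diffZl.
Qed.

(** The chain rule writes a derivative of the composite as a product to which
    the induction hypothesis applies; likewise for [Ck_comp2]. *)
Lemma Ck_comp1 V k (U : set V) (O : set R) (f : V -> R) (g : R -> R) :
  open U -> (forall x, U x -> O (f x)) ->
  Ck k O g -> Ck k U f -> Ck k U (fun x => g (f x)).
Proof.
move=> oU UO; elim: k f g UO => [|k IH] f g UO.
  move=> /= Cg Cf x Ux; apply: (@continuous_comp _ _ _ f g).
    exact: Cf.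
  exact/Cg/UO.
move=> Cg Cf; have [dg Dg] := Cg; have [df Df] := Cf; split=> [x Ux|v].
  by apply: (@differentiable_comp _ _ _ _ f g); [exact: df|exact/dg/UO].
apply: (Ck_eq oU _ (Ck_mul oU (Df v) (IH _ _ UO (Dg 1) (CkW Cf)))) => x Ux.
by apply/esym/D_comp1; [exact: df|exact/dg/UO].
Qed.

Lemma Ck_comp2 V k (U : set V) (O : set (R * R)) (a b : V -> R)
    (g : R * R -> R) :
  open U -> (forall x, U x -> O (a x, b x)) ->
  Ck k O g -> Ck k U a -> Ck k U b -> Ck k U (fun x => g (a x, b x)).
Proof.
move=> oU; elim: k a b g => [|k IH] a b g UO.
  move=> /= Cg Ca Cb x Ux.
  apply: (@continuous_comp _ _ _ (fun x => (a x, b x)) g).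
    exact: (cvg_pair (Ca x Ux) (Cb x Ux)).
  exact/Cg/UO.
move=> Cg Ca Cb; have [dg Dg] := Cg; have [da Da] := Ca; have [db Db] := Cb.
split=> [x Ux|v].
  apply: (@differentiable_comp _ _ _ _ (fun x => (a x, b x))).
    by apply: differentiable_pair; [exact: da|exact: db].
  exact/dg/UO.
apply: (Ck_eq oU _ (Ck_add oU
  (Ck_mul oU (Da v) (IH _ _ _ UO (Dg (1, 0)) (CkW Ca) (CkW Cb)))
  (Ck_mul oU (Db v) (IH _ _ _ UO (Dg (0, 1)) (CkW Ca) (CkW Cb))))) => x Ux.
by apply/esym/D_comp2; [exact: da|exact: db|exact/dg/UO].
Qed.

Lemma Ck_precomp V V' W k (U : set V') (l : {linear V -> V'}) (g : V' -> W) :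
  continuous l -> open U -> Ck k U g -> Ck k (l @^-1` U) (g \o l).
Proof.
move=> cl oU; have oU' : open (l @^-1` U).
  by apply: open_comp => // x _; exact: cl.
elim: k g => [|k IH] g /=.
  by move=> Cg x Ux; apply: continuous_comp; [exact: cl|exact: Cg].
have dl x : differentiable l x by exact: linear_differentiable.
move=> [dg Cg]; split=> [x Ux|v].
  exact: (@differentiable_comp _ _ _ _ l g _ (dl x) (dg _ Ux)).
apply: (Ck_eq oU' _ (IH _ (Cg (l v)))) => x Ux /=.
have dgl : differentiable (g \o l) x.
  exact: (@differentiable_comp _ _ _ _ l g _ (dl x) (dg _ Ux)).
rewrite [RHS]deriveE// diff_comp//; last exact: dg.
by rewrite /= diff_lin// deriveE//; exact: dg.
Qed.

Lemma Ck_coord V m n k (U : set V) (M : V -> 'M[R]_(m, n)) i j : open U ->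
  Ck k U M -> Ck k U (fun x => M x i j).
Proof.
move=> oU; elim: k M => [|k IH] M /=.
  move=> CM x Ux; apply: (@continuous_comp _ _ _ M (fun N => N i j)).
    exact: CM.
  exact: coord_continuous.
move=> [dM CM]; split=> [x Ux|v].
  apply: (@differentiable_comp _ _ _ _ M (fun N => N i j)); first exact: dM.
  exact: differentiable_coord.
apply: (Ck_eq oU _ (IH _ (CM v))) => x Ux.
by rewrite D_coord//; exact: dM.
Qed.

End Ck_theory.

Section smooth.
Context {R : realType}.
Implicit Types V W : normedModType R.

Definition smooth V W (U : set V) (f : V -> W) := forall k, Ck k U f.

Section rules.
Context {V : normedModType R} {U : set V}.
Hypothesis oU : open U.

Lemma smooth_eq W (f g : V -> W) : (forall x, U x -> f x = g x) ->
  smooth U f -> smooth U g.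
Proof. by move=> fg Cf k; exact: Ck_eq (Cf k). Qed.

Lemma smooth_subset W (U' : set V) (f : V -> W) :
  U `<=` U' -> smooth U' f -> smooth U f.
Proof. by move=> UU' Cf k; exact: Ck_subset (Cf k). Qed.

Lemma smooth_diff W (f : V -> W) x : smooth U f -> U x -> differentiable f x.
Proof. by move=> Cf; have [/= df _] := Cf 1%N; exact: df. Qed.

Lemma smooth_cont W (f : V -> W) x : smooth U f -> U x ->
  {for x, continuous f}.
Proof. by move=> Cf; exact: (Cf 0%N). Qed.

Lemma smooth_D W (f : V -> W) v : smooth U f -> smooth U ('D_v f).
Proof. by move=> Cf k; have [_] := Cf k.+1; exact. Qed.

Lemma smooth_cst W (c : W) : smooth U (fun=> c).
Proof. by move=> k; exact: Ck_cst. Qed.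

Lemma smooth_add W (f g : V -> W) : smooth U f -> smooth U g ->
  smooth U (fun x => f x + g x).
Proof. by move=> Cf Cg k; exact: Ck_add. Qed.

Lemma smooth_mul (f g : V -> R) : smooth U f -> smooth U g ->
  smooth U (fun x => f x * g x).
Proof. by move=> Cf Cg k; exact: Ck_mul. Qed.

Lemma smooth_scalel W (f : V -> R) (w : W) : smooth U f ->
  smooth U (fun x => f x *: w).
Proof. by move=> Cf k; exact: Ck_scalel. Qed.

Lemma smooth_opp (f : V -> R) : smooth U f -> smooth U (fun x => - f x).
Proof.
move=> Cf; apply: smooth_eq _ (smooth_mul (smooth_cst (-1 : R)) Cf) => x _.
by rewrite mulN1r.
Qed.

Lemma smooth_sub (f g : V -> R) : smooth U f -> smooth U g ->
  smooth U (fun x => f x - g x).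
Proof. by move=> Cf Cg; apply: smooth_add => //; exact: smooth_opp. Qed.

Lemma smooth_sum W n (f : 'I_n -> V -> W) : (forall i, smooth U (f i)) ->
  smooth U (fun x => \sum_i f i x).
Proof.
elim: n f => [|n IH] f Cf.
  by apply: smooth_eq _ (smooth_cst 0) => x _; rewrite big_ord0.
apply: smooth_eq _ (smooth_add (Cf ord0) (IH _ (fun i => Cf (lift ord0 i)))).
by move=> x _; rewrite big_ord_recl.
Qed.

Lemma smooth_comp1 (O : set R) (f : V -> R) (g : R -> R) :
  (forall x, U x -> O (f x)) ->
  smooth O g -> smooth U f -> smooth U (fun x => g (f x)).
Proof. by move=> UO Cg Cf k; exact: Ck_comp1 (Cg k) (Cf k). Qed.

Lemma smooth_comp2 (O : set (R * R)) (a b : V -> R) (g : R * R -> R) :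
  (forall x, U x -> O (a x, b x)) ->
  smooth O g -> smooth U a -> smooth U b -> smooth U (fun x => g (a x, b x)).
Proof. by move=> UO Cg Ca Cb k; exact: Ck_comp2 (Cg k) (Ca k) (Cb k). Qed.

Lemma smooth_coord m n (M : V -> 'M[R]_(m, n)) i j :
  smooth U M -> smooth U (fun x => M x i j).
Proof. by move=> CM k; exact: Ck_coord. Qed.

End rules.

Lemma smooth_precomp V V' W (U : set V') (l : {linear V -> V'}) (g : V' -> W) :
  continuous l -> open U -> smooth U g -> smooth (l @^-1` U) (g \o l).
Proof. by move=> cl oU Cg k; exact: Ck_precomp. Qed.

Lemma smooth_snd V' V W (U : set V) (f : V -> W) : open U -> smooth U f ->
  smooth [set z : V' * V | U z.2] (fun z => f z.2).
Proof.
move=> oU Cf.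
by apply: (@smooth_precomp (V' * V)%type V W U snd) => // z; exact: cvg_snd.
Qed.

Lemma smooth_lin V W (l : {linear V -> W}) (U : set V) :
  continuous l -> smooth U l.
Proof.
move=> cl [|k] /=; first by move=> x _; exact: cl.
split=> [x _|v]; first exact: linear_differentiable.
rewrite (_ : 'D_v l = cst (l v)); first exact: Ck_cst.
apply/funext => x; rewrite deriveE; last exact: linear_differentiable.
by rewrite diff_lin.
Qed.

Lemma smooth_fst V' V (U : set (V' * V)) : smooth U (@fst V' V).
Proof. by apply: (@smooth_lin (V' * V)%type V' fst) => z; exact: cvg_fst. Qed.

Lemma smooth_entry m n (U : set 'M[R]_(m, n)) i j :
  smooth U (fun M : 'M[R]_(m, n) => M i j).
Proof.
have @f : {linear 'M[R]_(m, n) -> R}.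
  by exists (fun N : 'M[R]_(_, _) => N i j); do 2![eexists]; do ?[constructor];
     rewrite ?mxE// => ? *; rewrite ?mxE//; move=> ?; rewrite !mxE.
by apply: (@smooth_lin _ _ f) => //; exact: coord_continuous.
Qed.

End smooth.

(** * Symmetry of second derivatives *)

Section reparametrization.
Context {R : realType} {V V' W : normedModType R}.

(** An affine change of variables does not alter the difference quotients. This
    serves for lines, for slices of a product and for [rV_cons]. *)
Lemma derivable_affine (g : V' -> W) (A : V -> V') w w' p :
  (forall h : R, A (h *: w + p) = h *: w' + A p) ->
  derivable g (A p) w' -> derivable (g \o A) p w.
Proof.
move=> AE; rewrite /derivable.
have -> // : (fun h : R => h^-1 *: ((g \o A \o shift p) (h *: w) - (g \o A) p)) =
  (fun h => h^-1 *: ((g \o shift (A p)) (h *: w') - g (A p))).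
by rewrite funeqE => h /=; rewrite AE.
Qed.

Lemma derive_affine (g : V' -> W) (A : V -> V') w w' p :
  (forall h : R, A (h *: w + p) = h *: w' + A p) ->
  'D_w (g \o A) p = 'D_w' g (A p).
Proof.
move=> AE; rewrite /derive.
have -> // : (fun h : R => h^-1 *: ((g \o A \o shift p) (h *: w) - (g \o A) p)) =
  (fun h => h^-1 *: ((g \o shift (A p)) (h *: w') - g (A p))).
by rewrite funeqE => h /=; rewrite AE.
Qed.

End reparametrization.

Section schwarz.
Context {R : realType} {V : normedModType R}.

Lemma MVT_line (F : V -> R) x v (h : R) : 0 < h ->
  (forall s, 0 <= s <= h -> differentiable F (x + s *: v)) ->
  exists2 c, 0 <= c <= h & F (x + h *: v) - F x = h * 'D_v F (x + c *: v).
Proof.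
move=> h0 dF; pose G s := F (x + s *: v).
have AE s k : x + (k *: (1 : R) + s) *: v = k *: v + (x + s *: v).
  by rewrite scalerDl addrCA [k *: 1]mulr1.
have dG s : 0 <= s <= h -> is_derive s (1:R) G ('D_v F (x + s *: v)).
  move=> sh; have dFs : derivable F (x + s *: v) v.
    exact/diff_derivable/dF.
  apply: DeriveDef; first exact: (derivable_affine (AE s) dFs).
  exact: (derive_affine _ (AE s)).
have H s : s \in `]0, h[ -> 0 <= s <= h.
  by rewrite in_itv/= => /andP[s0 sh]; rewrite !ltW.
case: (@MVT R G (fun s => 'D_v F (x + s *: v)) _ _ h0).
- by move=> s /H; exact: dG.
- apply: derivable_within_continuous => s; rewrite in_itv/= => /dG dGs.
  exact: ex_derive.
move=> c /H ch; rewrite /G scale0r addr0 subr0 => ->; exists c => //.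
by rewrite mulrC.
Qed.

(** The mean value theorem twice: along [a] for [f (y + h *: b) - f y], then
    along [b] for ['D_a f]. *)
Lemma second_difference (U : set V) (f : V -> R) x a b (h : R) :
  smooth U f -> 0 < h ->
  (forall s t, 0 <= s <= h -> 0 <= t <= h -> U (x + s *: a + t *: b)) ->
  exists s t, [/\ 0 <= s <= h, 0 <= t <= h &
    f (x + h *: a + h *: b) - f (x + h *: a) - f (x + h *: b) + f x =
    h ^+ 2 * 'D_b ('D_a f) (x + s *: a + t *: b)].
Proof.
move=> Cf h0 UE.
have hh : 0 <= h <= h by rewrite lexx ltW.
have h00 : 0 <= (0 : R) <= h by rewrite lexx ltW.
have U1 s : 0 <= s <= h -> U (x + h *: b + s *: a).
  by move=> sh; rewrite addrAC; exact: UE.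
have U0 s : 0 <= s <= h -> U (x + s *: a).
  by move=> sh; rewrite -[_ + _]addr0 -(scale0r b); exact: UE.
pose F y := f (y + h *: b) - f y.
have df y : U y -> differentiable f y by exact: smooth_diff.
have dfb y : U (y + h *: b) -> differentiable (fun z => f (z + h *: b)) y.
  move=> Uy; apply: (@differentiable_comp _ _ _ _ (fun z => z + h *: b) f).
    by apply: (@differentiableD _ _ _ id (cst _)).
  exact: df.
have Db y : U (y + h *: b) ->
    'D_a (fun z => f (z + h *: b)) y = 'D_a f (y + h *: b).
  move=> Uy; apply: (@derive_affine _ _ _ _ f (fun z => z + h *: b)) => k.
  by rewrite addrA.
have [s sh Fs] : exists2 s, 0 <= s <= h &
    F (x + h *: a) - F x = h * 'D_a F (x + s *: a).
  apply: MVT_line => // s sh; apply: differentiableB; last exact/df/U0.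
  by apply: dfb; rewrite addrAC; exact: U1.
have [t th Ft] : exists2 t, 0 <= t <= h &
    'D_a f (x + s *: a + h *: b) - 'D_a f (x + s *: a) =
    h * 'D_b ('D_a f) (x + s *: a + t *: b).
  apply: (@MVT_line ('D_a f) _ b h h0) => t th.
  exact: (smooth_diff (smooth_D a Cf) (UE _ _ sh th)).
exists s, t; split=> //; rewrite expr2 -mulrA -Ft.
move: Fs; rewrite /F D_sub; last 2 first.
- by apply: dfb; rewrite addrAC; exact: U1.
- exact/df/U0.
rewrite Db; last by rewrite addrAC; exact: U1.
by move=> <-; ring.
Qed.

(** The second difference is symmetric in its two directions, so [FA] and [FB]
    share a value at points arbitrarily close to [x], and continuity concludes. *)
Lemma eq_second_difference (U : set V) (f FA FB : V -> R) x v w :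
  open U -> U x -> {for x, continuous FA} -> {for x, continuous FB} ->
  (forall h, 0 < h ->
    (forall s t, 0 <= s <= h -> 0 <= t <= h -> U (x + s *: v + t *: w)) ->
    exists s t, [/\ 0 <= s <= h, 0 <= t <= h &
      f (x + h *: v + h *: w) - f (x + h *: v) - f (x + h *: w) + f x =
      h ^+ 2 * FB (x + s *: v + t *: w)]) ->
  (forall h, 0 < h ->
    (forall s t, 0 <= s <= h -> 0 <= t <= h -> U (x + s *: w + t *: v)) ->
    exists s t, [/\ 0 <= s <= h, 0 <= t <= h &
      f (x + h *: w + h *: v) - f (x + h *: w) - f (x + h *: v) + f x =
      h ^+ 2 * FA (x + s *: w + t *: v)]) ->
  FA x = FB x.
Proof.
move=> oU Ux cA cB sec1 sec2.
apply/eqP; rewrite -subr_eq0 -normr_eq0 eq_le normr_ge0 andbT.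
rewrite leNgt; apply/negP => AB.
pose e := `|FA x - FB x| / 2.
have e0 : 0 < e by rewrite divr_gt0.
have nU : nbhs x U by exact: open_nbhs_nbhs.
have /cvgrPdist_lt/(_ e e0) nA : FA y @[y --> x] --> FA x := cA.
have /cvgrPdist_lt/(_ e e0) nB : FB y @[y --> x] --> FB x := cB.
have : nbhs x (fun y => [/\ U y, `|FA x - FA y| < e & `|FB x - FB y| < e]).
  by apply: filterS3 nU nA nB => y Uy Ay By; split.
move=> /nbhs_ballP[r /= r0 xr].
pose h := r / (2 * (`|v| + `|w| + 1)).
have n0 : 0 < `|v| + `|w| + 1 by rewrite ltr_wpDl// addr_ge0.
have h0 : 0 < h by rewrite divr_gt0// mulr_gt0.
have near_x s t : 0 <= s <= h -> 0 <= t <= h -> ball x r (x + s *: v + t *: w).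
  move=> /andP[s0 sh] /andP[t0 th].
  rewrite -ball_normE /ball_/= -addrA opprD addNKr normrN.
  apply: (le_lt_trans (ler_normD _ _)); rewrite !normrZ !ger0_norm//.
  have : s * `|v| + t * `|w| <= h * (`|v| + `|w|).
    by rewrite mulrDr lerD// ler_wpM2r.
  move=> /le_lt_trans; apply.
  have -> : h * (`|v| + `|w|) = r / 2 * ((`|v| + `|w|) / (`|v| + `|w| + 1)).
    by rewrite /h; field; lra.
  have : (`|v| + `|w|) / (`|v| + `|w| + 1) <= 1.
    by rewrite ler_pdivrMr// mul1r lerDl.
  have : 0 <= (`|v| + `|w|) / (`|v| + `|w| + 1).
    by rewrite divr_ge0// ?addr_ge0// ltW.
  by nra.
have near_x' s t : 0 <= s <= h -> 0 <= t <= h ->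
    ball x r (x + s *: w + t *: v).
  by move=> sh th; rewrite addrAC; exact: near_x.
have [s [t [sh th E1]]] := sec1 h h0
  (fun s t sh th => let: And3 U _ _ := xr _ (near_x s t sh th) in U).
have [s' [t' [sh' th' E2]]] := sec2 h h0
  (fun s t sh th => let: And3 U _ _ := xr _ (near_x' s t sh th) in U).
have [_ _ Be] := xr _ (near_x s t sh th).
have [_ Ae _] := xr _ (near_x' s' t' sh' th').
have E : FB (x + s *: v + t *: w) = FA (x + s' *: w + t' *: v).
  have h2 : h ^+ 2 != 0 by rewrite expf_neq0// gt_eqF.
  by apply: (mulfI h2); rewrite -E1 -E2 (addrAC x); ring.
have : `|FA x - FB x| < e + e.
  rewrite (_ : FA x - FB x = (FA x - FA (x + s' *: w + t' *: v)) -
    (FB x - FB (x + s *: v + t *: w))); last by rewrite E; ring.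
  by apply: le_lt_trans (ler_normB _ _) _; exact: ltrD.
by rewrite /e -splitr ltxx.
Qed.

(** Schwarz's theorem. *)
Lemma derive_comm (U : set V) (f : V -> R) v w x : open U -> smooth U f ->
  U x -> 'D_v ('D_w f) x = 'D_w ('D_v f) x.
Proof.
move=> oU Cf Ux; apply: (@eq_second_difference U f
  ('D_v ('D_w f)) ('D_w ('D_v f)) x v w oU Ux).
- exact: smooth_cont (smooth_D v (smooth_D w Cf)) Ux.
- exact: smooth_cont (smooth_D w (smooth_D v Cf)) Ux.
- by move=> h; exact: second_difference Cf.
- by move=> h; exact: second_difference Cf.
Qed.

End schwarz.

(** * Smooth functions with compact support *)

Section flat.
Context {R : realType}.
Implicit Types x : R.

(** The derivative of a member of this family is a combination of other members,
    hence all of them are smooth; [flat 0] is the classical flat function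
    [exp (- 1 / x)]. *)
Definition flat n x : R :=
  if 0 < x then x ^- n * expR (- x^-1) else 0.

Lemma flat_ge0 n x : 0 <= flat n x.
Proof.
rewrite /flat; case: ifPn => // x0; rewrite mulr_ge0 ?expR_ge0//.
by rewrite invr_ge0 exprn_ge0// ltW.
Qed.

(** This is [y ^+ n <= n! * exp y] at [y = 1 / x]. *)
Lemma flat_le n x : flat n x <= n`!%:R.
Proof.
rewrite /flat; case: ifPn => // x0; rewrite expRN ler_pdivrMr ?expR_gt0//.
have y0 : 0 <= x^-1 by rewrite invr_ge0 ltW.
rewrite -exprVn; case: n => [|n].
  by rewrite expr0 fact0 mul1r (le_trans _ (expR_ge1Dx _))// lerDl.
have f0 : 0 < (n.+1)`!%:R :> R by rewrite ltr0n fact_gt0.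
rewrite mulrC -ler_pdivrMr//; apply: le_trans (expR_ge1Dxn n y0).
by rewrite lerDr.
Qed.

(** Together with the uniform bound on [flat n.+2], this makes [flat n] decay
    quadratically at the origin, where its derivative therefore vanishes. *)
Lemma flat_shift n x : flat n x = x ^+ 2 * flat n.+2 x.
Proof.
rewrite /flat; case: ifPn => x0; last by rewrite mulr0.
rewrite mulrA; congr (_ * _).
have xn0 : x != 0 by rewrite gt_eqF.
have : x ^+ n != 0 by rewrite expf_neq0.
by rewrite -[n.+2]addn2 (exprD x n 2); set z := x ^+ n => z0; field; rewrite xn0 z0.
Qed.

Lemma is_derive_flat n x :
  is_derive x 1 (flat n) (flat n.+2 x - n%:R * flat n.+1 x).
Proof.
have [x0|x0|->] := ltgtP x 0.
- have e : \near x, (cst 0 : R -> R) x = flat n x.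
    near=> y; rewrite /flat/= ltNge (_ : y <= 0)//.
    by apply/ltW; near: y; exact: lt_nbhsl.
  rewrite [X in is_derive _ _ _ X](_ : _ = 0); last first.
    by rewrite /flat ltNge ltW//= mulr0 subr0.
  apply: DeriveDef.
    by apply: near_eq_derivable e _; exact: derivable_cst.
  by rewrite -(near_eq_derive _ e) derive_cst.
- have e : \near x, (x^-1) ^+ n * expR (- x^-1) = flat n x.
    near=> y; rewrite /flat/= exprVn (_ : 0 < y)//.
    by near: y; exact: lt_nbhsr.
  have xn0 : x != 0 by rewrite gt_eqF.
  have d : is_derive x 1 (fun y : R => (y^-1) ^+ n * expR (- y^-1))
      (flat n.+2 x - n%:R * flat n.+1 x).
    have dV : is_derive x 1 (fun y : R => y^-1) (- x ^- 2).
      apply: is_derive_eq; first exact: is_deriveV.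
      by rewrite [_ *: 1]mulr1.
    have dN : is_derive x 1 (fun y : R => - y^-1) (x ^- 2).
      by apply: is_derive_eq (opprK _); exact: (is_deriveN dV).
    have dE : is_derive x 1 (fun y : R => expR (- y^-1))
        (expR (- x^-1) * x ^- 2).
      exact: (@is_derive1_comp _ expR (fun y => - y^-1) x _ _ (is_derive_expR _) dN).
    have dX : is_derive x 1 (fun y : R => (y^-1) ^+ n)
        (- (n%:R * (x^-1) ^+ n.+1)).
      have -> : (fun y : R => (y^-1) ^+ n) = (fun y : R => y^-1) ^+ n.
        by apply/funext => y; rewrite exprfctE.
      apply: is_derive_eq; rewrite /GRing.scale/=.
      case: n {e} => [|n]; first by rewrite !mul0r oppr0.
      by rewrite (exprS _ n.+1) (exprS _ n) succnK; move: (x^-1 ^+ n) => z; field.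
    apply: is_derive_eq (is_deriveM dX dE) _.
    rewrite /flat x0 /GRing.scale/= -!exprVn -[n.+2]addn2 -[n.+1]addn1.
    rewrite (exprD _ n 2) (exprD _ n 1) expr1.
    by move: (x^-1 ^+ n) (expR _) => z w; field.
  case: d => d1 d2; apply: DeriveDef.
    by apply: near_eq_derivable e _; exact: d1.
  by rewrite -(near_eq_derive _ e).
rewrite [X in is_derive _ _ _ X](_ : _ = 0); last first.
  by rewrite /flat ltxx mulr0 subr0.
have E : (fun h : R => h^-1 *: ((flat n \o shift 0) (h *: (1 : R)) - flat n 0)) =
    (fun h => h * flat n.+2 h).
  apply/funext => h; rewrite /= addr0 [h *: 1]mulr1.
  rewrite {2}/flat ltxx subr0 flat_shift /GRing.scale/=.
  by have [->|h0] := eqVneq h 0; [rewrite invr0 !mul0r|field].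
have c0 : (h * flat n.+2 h) @[h --> (0:R)^'] --> (0 : R).
  apply/cvgr0Pnorm_lt => e e0; near=> h; rewrite normrM.
  rewrite (ger0_norm (flat_ge0 _ _)).
  apply: (le_lt_trans (ler_wpM2l _ (flat_le _ _))); first exact: normr_ge0.
  rewrite -ltr_pdivlMr; last by rewrite ltr0n fact_gt0.
  near: h; apply: dnbhs0_lt; rewrite divr_gt0// ltr0n fact_gt0//.
by apply: DeriveDef; rewrite /derivable /derive E; [apply: cvgP c0|exact: cvg_lim].
Unshelve. all: by end_near. Qed.

Lemma smooth_flat n (U : set R) : smooth U (flat n).
Proof.
suff : smooth setT (flat n) by apply: smooth_subset.
move=> k; elim: k n => [|k IH] n /=.
  move=> x _; apply/differentiable_continuous/derivable1_diffP.
  by have [] := is_derive_flat n x.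
have df x : differentiable (flat n) x.
  by apply/derivable1_diffP; have [] := is_derive_flat n x.
split=> [x _|v]; first exact: df.
have Cd : Ck k setT (fun x => v * (flat n.+2 x - n%:R * flat n.+1 x)).
  have o := @openT R.
  apply: Ck_mul => //; first exact: Ck_cst.
  apply: Ck_add => //.
  apply: (@Ck_eq _ _ _ _ _ (fun x => (- n%:R) * flat n.+1 x)) => //.
    by move=> x _; rewrite mulNr.
  by apply: Ck_mul => //; exact: Ck_cst.
apply: (Ck_eq _ _ Cd); first exact: openT.
move=> x _; have [d1 <-] := is_derive_flat n x.
by rewrite !deriveE// -[RHS]/('d (flat n) x v) -[v in RHS]mulr1 linearZ.
Qed.

End flat.

Section mollifier.
Context {R : realType} {d : nat}.
Local Notation spacetime := (R * 'rV[R]_d)%type.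
Implicit Types (c p : spacetime) (r : R).

(** A box rather than a Euclidean ball, so that its measure is a product of
    lengths. *)
Definition closed_box c r : set spacetime :=
  `[c.1 - r, c.1 + r] `*`
  [set v : 'rV[R]_d | forall i, v ord0 i \in `[c.2 ord0 i - r, c.2 ord0 i + r]].

(** Positive exactly on the open Euclidean ball of radius [r] around [c], which
    the box of half-side [r] contains. *)
Definition mollifier c r p : R :=
  flat 0 (r ^+ 2 - (p.1 - c.1) ^+ 2
          - \sum_i (p.2 ord0 i - c.2 ord0 i) ^+ 2).

Lemma smooth_time (U : set spacetime) : smooth U (fun p => p.1).
Proof. exact: smooth_fst. Qed.

Lemma smooth_space (U : set spacetime) i : open U ->
  smooth U (fun p => p.2 ord0 i).
Proof.
move=> oU; apply: (@smooth_subset _ _ _ _ setT) => //.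
have := smooth_snd R openT (smooth_entry (setT : set 'rV[R]_d) ord0 i).
by apply: smooth_subset.
Qed.

Lemma smooth_mollifier c r : smooth setT (mollifier c r).
Proof.
have oT := @openT spacetime.
have sq (f : spacetime -> R) a : smooth setT f ->
    smooth setT (fun p => (f p - a) ^+ 2).
  move=> Cf; have Cfa : smooth setT (fun p => f p - a).
    by apply: smooth_sub => //; exact: smooth_cst.
  by apply: (smooth_eq oT _ (smooth_mul oT Cfa Cfa)) => p _; rewrite expr2.
apply: (smooth_comp1 oT (O := setT)) => //; first exact: smooth_flat.
apply: (smooth_sub oT); last first.
  by apply: smooth_sum => // i; apply: sq; exact: smooth_space.
apply: (smooth_sub oT); first exact: smooth_cst.
by apply: sq; exact: smooth_time.
Qed.

Lemma mollifier_ge0 c r p : 0 <= mollifier c r p.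
Proof. exact: flat_ge0. Qed.

Lemma mollifier_gt0 c r : 0 < r -> 0 < mollifier c r c.
Proof.
move=> r0; rewrite /mollifier subrr big1; last by move=> i _; rewrite subrr expr0n.
rewrite expr0n/= !subr0 /flat exprn_gt0// expr0 invr1 mul1r; exact: expR_gt0.
Qed.

Lemma mollifier_support c r p : 0 < r -> mollifier c r p != 0 -> closed_box c r p.
Proof.
move=> r0; rewrite /mollifier /flat.
case: ifPn; last by rewrite eqxx.
have s0 : 0 <= \sum_i (p.2 ord0 i - c.2 ord0 i) ^+ 2.
  by apply: sumr_ge0 => i _; exact: sqr_ge0.
rewrite -addrA -opprD subr_gt0 => pr _.
have itvP (x y : R) : (x - y) ^+ 2 < r ^+ 2 -> x \in `[y - r, y + r].
  rewrite -real_normK ?num_real// ltr_pXn2r ?nnegrE ?normr_ge0 ?ltW//.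
  by rewrite in_itv/= ltr_norml => /andP[? ?]; apply/andP; split; lra.
split => /=.
  by apply: itvP; apply: le_lt_trans pr; rewrite lerDl.
move=> i; apply: itvP; apply: le_lt_trans pr; rewrite (bigD1 i)//= addrCA lerDl.
by rewrite addr_ge0 ?sqr_ge0// sumr_ge0// => j _; exact: sqr_ge0.
Qed.

Lemma mollifier_outside c r p : 0 < r -> ~ closed_box c r p ->
  mollifier c r p = 0.
Proof. by move=> r0; apply: contra_notP => /eqP; exact: mollifier_support. Qed.

Lemma closed_box_compact c r : compact (closed_box c r).
Proof.
apply: compact_setX; first exact: segment_compact.
by apply: (@rV_compact _ _ (fun i => `[c.2 ord0 i - r, c.2 ord0 i + r]%classic))
  => i; exact: segment_compact.
Qed.

Lemma closed_box_closed c r : closed (closed_box c r).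
Proof. exact: compact_closed (@closed_box_compact c r). Qed.

Lemma closed_box_ball c r e : r < e -> 0 < r -> closed_box c r `<=` ball c e.
Proof.
move=> re r0 p [/= p1 p2].
have e0 : 0 < e by exact: lt_trans re.
have itvP (x y : R) : x \in `[y - r, y + r] -> `|y - x| < e.
  by rewrite in_itv/= ltr_norml => /andP[? ?]; apply/andP; split; lra.
split; first exact: itvP.
by split=> // i j; rewrite ord1; apply: itvP; exact: p2.
Qed.

Lemma closed_box_sub (U : set spacetime) c : open U -> U c ->
  exists2 r, 0 < r & closed_box c r `<=` U.
Proof.
move=> oU Uc; have /nbhs_ballP[e /= e0 eU] : nbhs c U by exact: open_nbhs_nbhs.
exists (e / 2); first by rewrite divr_gt0.
by apply: subset_trans eU; apply: closed_box_ball; rewrite ?divr_gt0//; lra.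
Qed.

End mollifier.

(** * Borel sets of space-time *)

Section borel.
Context {R : realType}.

(** [r k x] names the cell of level [k] that contains [x]. A set that contains a
    small enough cell around each of its points is a countable union of cells. *)
Lemma measurable_of_cells d (T : measurableType d) (C : countType)
    (r : nat -> T -> C) (A : set T) :
  (forall k c, measurable (r k @^-1` [set c])) ->
  (forall x, A x -> exists k, forall y, r k y = r k x -> A y) ->
  measurable A.
Proof.
move=> mr Ar.
pose F (kc : nat * C) : set T :=
  if pselect (r kc.1 @^-1` [set kc.2] `<=` A) then r kc.1 @^-1` [set kc.2]
  else set0.
have -> : A = \bigcup_kc F kc.
  apply/seteqP; split => x.
    move=> /Ar[k kA]; exists (k, r k x) => //.
    by rewrite /F; case: pselect => //= -[].
  by move=> [kc _]; rewrite /F; case: pselect => // FA /FA.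
apply: countable_bigcupT_measurable => [|kc]; first exact: countableP.
by rewrite /F; case: pselect => ?; [exact: mr|exact: measurable0].
Qed.

Definition cell k (x : R) : int := Num.floor (k.+1%:R * x).

Lemma measurable_cell k c : measurable [set x : R | cell k x = c].
Proof.
rewrite (_ : [set _ | _] =
    `[c%:~R / k.+1%:R, (c + 1)%:~R / k.+1%:R[%classic); first by [].
have k0 : 0 < k.+1%:R :> R by [].
apply/seteqP; split => x /=; rewrite in_itv/= ler_pdivrMr// ltr_pdivlMr//
  mulrC /cell; last exact: floor_def.
by move=> <-; apply: real_floor_itv; exact: num_real.
Qed.

Lemma cell_dist k (x y : R) : cell k x = cell k y -> `|x - y| < k.+1%:R^-1.
Proof.
have k0 : 0 < k.+1%:R :> R by [].
rewrite /cell => xy.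
have /andP[x1 x2] := real_floor_itv (num_real (k.+1%:R * x)).
have /andP[y1 y2] := real_floor_itv (num_real (k.+1%:R * y)).
rewrite -div1r ltr_pdivlMr// -[X in _ * X](gtr0_norm k0) -normrM.
move: x1 x2 y1 y2; rewrite xy !intrD mulr1z => x1 x2 y1 y2.
rewrite ltr_norml; apply/andP; split; lra.
Qed.

Lemma small_cells (e : R) : 0 < e -> exists k, k.+1%:R^-1 < e.
Proof.
move=> e0; exists (Num.bound e^-1).
rewrite -[X in _ < X]invrK ltf_pV2 ?posrE ?invr_gt0//.
apply: lt_le_trans (archi_boundP _) _; first by rewrite invr_ge0 ltW.
by rewrite ler_nat leqnSn.
Qed.

Definition cell_rV n k (v : 'rV[R]_n) : {ffun 'I_n -> int} :=
  [ffun i => cell k (v ord0 i)].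

Lemma measurable_cell_rV n k c : measurable [set v | @cell_rV n k v = c].
Proof.
rewrite (_ : [set _ | _] = \bigcap_(i in [set: 'I_n])
    (@rV_coord R n i @^-1` [set x | cell k x = c i])).
  apply: fin_bigcap_measurable => // i _; rewrite -[_ @^-1` _]setTI.
  by apply: measurable_rV_coord => //; exact: measurable_cell.
apply/seteqP; split => v /=.
  by move=> <- i _ /=; rewrite ffunE.
by move=> vc; apply/ffunP => i; rewrite ffunE; exact: vc.
Qed.

Lemma ball_cell_rV n (v w : 'rV[R]_n) k e : k.+1%:R^-1 < e ->
  cell_rV k w = cell_rV k v -> ball v e w.
Proof.
move=> ke vw; split; first exact: le_lt_trans ke.
move=> i j; rewrite ord1 /ball/=; apply: lt_trans ke.
apply: (@cell_dist k); have /ffunP/(_ j) := vw; by rewrite !ffunE.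
Qed.

(** The sigma-algebra is generated by the coordinates, and the topology is that
    of the sup norm: the cells are cubes of side [1 / k.+1]. *)
Lemma open_measurable_rV n (A : set 'rV[R]_n) : open A -> measurable A.
Proof.
move=> oA; apply: (@measurable_of_cells _ _ _ (@cell_rV n)).
  exact: measurable_cell_rV.
move=> v Av; have /nbhs_ballP[e /= e0 eA] : nbhs v A by exact: open_nbhs_nbhs.
have [k ke] := small_cells e0; exists k => w vw; apply: eA.
exact: ball_cell_rV vw.
Qed.

Lemma open_measurable_spacetime n (A : set (R * 'rV[R]_n)) :
  open A -> measurable A.
Proof.
move=> oA; apply: (@measurable_of_cells _ _ _
  (fun k p => (cell k p.1, @cell_rV n k p.2))).
  move=> k [c1 c2]; rewrite (_ : _ @^-1` _ =
      [set x | cell k x = c1] `*` [set v | @cell_rV n k v = c2]); last first.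
    by apply/seteqP; split => p /= [-> ->].
  by apply: measurableX; [exact: measurable_cell|exact: measurable_cell_rV].
move=> p Ap; have /nbhs_ballP[e /= e0 eA] : nbhs p A by exact: open_nbhs_nbhs.
have [k ke] := small_cells e0; exists k => q -[pq1 pq2]; apply: eA; split.
  by apply: lt_trans ke; apply: (@cell_dist k).
exact: ball_cell_rV pq2.
Qed.

Lemma measurable_rV_continuous n (f : 'rV[R]_n -> R) :
  continuous f -> measurable_fun setT f.
Proof.
move=> cf _; apply: (measurability _ (measurable_realfun.RGenOInfty.measurableE R)) => //.
move=> /= _ [_ [a ->]] <-; rewrite setTI; apply: open_measurable_rV.
by apply: open_comp => //; exact: interval_open.
Qed.

Lemma measurable_spacetime_continuous n (D U : set (R * 'rV[R]_n))
    (f : R * 'rV[R]_n -> R) :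
  open U -> measurable D -> D `<=` U -> (forall p, U p -> {for p, continuous f}) ->
  measurable_fun D f.
Proof.
move=> oU mD DU cf _; apply: (measurability _ (measurable_realfun.RGenOInfty.measurableE R)) => //.
move=> /= _ [_ [a ->]] <-.
rewrite (_ : D `&` _ = D `&` (U `&` f @^-1` `]a, +oo[%classic)).
  apply: measurableI => //; apply: open_measurable_spacetime.
  rewrite openE => p [Up fp]; rewrite /interior; apply: filterI.
    exact: open_nbhs_nbhs.
  apply: cf => //; apply: open_nbhs_nbhs; split => //; exact: interval_open.
rewrite setIA (_ : D `&` U = D)//; exact: setIidl.
Qed.

Lemma measurable_closed_box n c r : measurable (@closed_box R n c r).
Proof.
rewrite -[closed_box _ _]setCK; apply: measurableC.
by apply: open_measurable_spacetime; apply: closed_openC; exact: closed_box_closed.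
Qed.

End borel.

(** * Integrals of derivatives *)

Section integral_support.
Context d (T : measurableType d) (R : realType) (mu : {measure set T -> \bar R}).

Lemma integral_support (D : set T) (f : T -> \bar R) :
  (forall x, ~ D x -> f x = 0%E) ->
  (\int[mu]_(x in D) f x = \int[mu]_x f x)%E.
Proof.
move=> f0; rewrite integral_mkcond; apply: eq_integral => x _.
by rewrite patchE; case: ifPn => // /negP; rewrite inE => /f0 ->.
Qed.

Lemma integrable_support (D : set T) (f : T -> \bar R) : measurable D ->
  (forall x, ~ D x -> f x = 0%E) ->
  mu.-integrable D f -> mu.-integrable setT f.
Proof.
move=> mD f0 /(integrable_mkcond _ mD); apply: eq_integrable => // x _.
by rewrite patchE; case: ifPn => // /negP; rewrite inE => /f0 ->.
Qed.

End integral_support.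

Lemma continuous_pairr (R : realType) (V W : normedModType R) (x : V) :
  continuous (fun w : W => (x, w)).
Proof. by move=> w; exact: cvg_pair (cvg_cst _) cvg_id. Qed.

Section parts.
Context {R : realType}.
Local Notation leb := (@lebesgue_measure R).
Local Notation lebST n := (leb \x lebesgue_rV n)%E.

(** The fundamental theorem of calculus on [a - 1, b + 1], at whose ends [h] is
    zero. *)
Lemma integral_derive1_eq0 (h : R -> R) a b :
  a < b -> (forall x, derivable h x 1) -> continuous ('D_1 h) ->
  (forall x, x \notin `[a, b] -> h x = 0) ->
  (forall x, x \notin `[a, b] -> 'D_1 h x = 0) ->
  (\int[leb]_x ('D_1 h x)%:E = 0)%E.
Proof.
move=> ab dh cdh h0 dh0.
have ch x : {for x, continuous h}.
  by apply/differentiable_continuous/derivable1_diffP.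
have ab' : a - 1 < b + 1 by lra.
rewrite -(@integral_support _ _ _ leb `[a - 1, b + 1]%classic
  (fun x => ('D_1 h x)%:E)); last first.
  move=> x /negP xab; rewrite dh0//; apply: contra xab.
  by rewrite !in_itv/= => /andP[H1 H2]; apply/andP; split; lra.
rewrite (@continuous_FTC2 _ _ h _ _ ab')//.
- rewrite !h0 ?subee// in_itv/=; apply/negP => /andP[]; lra.
- by apply: continuous_subspaceT.
- by split=> [x _||] //; [apply: cvg_at_right_filter|apply: cvg_at_left_filter];
    exact: ch.
- by move=> x _; rewrite derive1E.
Qed.

(** [None] stands for time: the [d + 1] directions of space-time are then treated
    alike. *)
Definition edir n (o : option 'I_n) : R * 'rV[R]_n :=
  if o is Some i then (0, delta_mx ord0 i) else (1, 0).

Lemma closed_box_measure n (c : R * 'rV[R]_n) r :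
  (lebST n (closed_box c r) = leb `[(c.1 - r)%R, (c.1 + r)%R]%classic *
   \prod_i leb `[(c.2 ord0 i - r)%R, (c.2 ord0 i + r)%R]%classic)%E.
Proof.
have mB : measurable [set v : 'rV[R]_n | forall i,
    `[c.2 ord0 i - r, c.2 ord0 i + r]%classic (v ord0 i)].
  rewrite (_ : [set _ | _] = \bigcap_(i in [set: 'I_n])
      (@rV_coord R n i @^-1` `[c.2 ord0 i - r, c.2 ord0 i + r])).
    apply: fin_bigcap_measurable => // i _; rewrite -[_ @^-1` _]setTI.
    exact: measurable_rV_coord.
  by apply/seteqP; split => v Bv i; [move=> _|]; exact: Bv.
have mA : measurable `[c.1 - r, c.1 + r]%classic by exact: measurable_itv.
rewrite /closed_box; have -> := product_measure1E leb (lebesgue_rV n) mA mB.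
by have -> := lebesgue_rV_box
  (A := fun i => `[c.2 ord0 i - r, c.2 ord0 i + r]%classic)
  (fun i => measurable_itv _).
Qed.

Lemma closed_box_finite n (c : R * 'rV[R]_n) r :
  (lebST n (closed_box c r) < +oo)%E.
Proof.
have itv_fin (x y : R) : leb `[x, y]%classic \is a fin_num.
  by rewrite lebesgue_measure_itv; case: ifP => // _; rewrite -EFinB.
rewrite closed_box_measure ltey_eq fin_numM ?itv_fin//.
by elim/big_ind : _ => // x y; exact: fin_numM.
Qed.

Lemma closed_box_measure_gt0 n (c : R * 'rV[R]_n) r : 0 < r ->
  (0 < lebST n (closed_box c r))%E.
Proof.
move=> r0; rewrite closed_box_measure.
have itv_gt0 (x : R) : (0 < leb `[(x - r)%R, (x + r)%R]%classic)%E.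
  rewrite lebesgue_measure_itv/= lte_fin.
  by rewrite (_ : x - r < x + r) -?EFinB ?lte_fin; lra.
apply: mule_gt0; first exact: itv_gt0.
by elim/big_ind : _ => // x y; exact: mule_gt0.
Qed.

Lemma integrable_closed_box n (U : set (R * 'rV[R]_n)) (f : R * 'rV[R]_n -> R) c r :
  open U -> closed_box c r `<=` U -> (forall p, U p -> {for p, continuous f}) ->
  (lebST n).-integrable (closed_box c r) (EFin \o f).
Proof.
move=> oU KU cf.
apply: measurable_bounded_integrable.
- exact: measurable_closed_box.
- exact: closed_box_finite.
- apply: (measurable_spacetime_continuous oU) => //.
  exact: measurable_closed_box.
- have : compact (f @` closed_box c r).
    apply: continuous_compact; last exact: closed_box_compact.
    apply: continuous_in_subspaceT => p; rewrite inE => Kp; exact/cf/KU.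
  move=> /compact_bounded [M [Mr HM]]; exists M; split => // x Mx p Kp.
  by apply: HM Mx _ _; exists p.
Qed.

Lemma integral_rV_cons n (f : 'rV[R]_n.+1 -> R) :
  measurable_fun [set: 'rV[R]_n.+1] f ->
  (lebST n).-integrable setT (EFin \o (f \o @rV_cons R n)) ->
  (\int[lebesgue_rV n.+1]_v (f v)%:E =
   \int[lebST n]_p (f (rV_cons p))%:E)%E.
Proof.
move=> mf fi; have mE : measurable_fun [set: 'rV[R]_n.+1] (EFin \o f).
  exact/measurable_EFinP.
exact: (@integral_pushforward _ _ (measurableTypeR R * 'rV[R]_n)%type
  'rV[R]_n.+1 R _ (@measurable_rV_cons R n) (lebST n) setT _ mE fi measurableT).
Qed.

Lemma integrable_derive m (e : R * 'rV[R]_m) (h : R * 'rV[R]_m -> R) M :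
  continuous ('D_e h) -> (forall p, ~ closed_box 0 M p -> 'D_e h p = 0) ->
  (lebST m).-integrable setT (EFin \o 'D_e h).
Proof.
move=> cD D0; apply: (@integrable_support _ (measurableTypeR R * 'rV[R]_m)%type
  _ (lebST m) (closed_box 0 M) _ (measurable_closed_box 0 M)).
  by move=> p /D0 /= ->.
by apply: (integrable_closed_box (@openT _)) => // p _; exact: cD.
Qed.

(** Fubini's theorem with time as the inner variable: each slice is a
    one-dimensional integral of a derivative. *)
Lemma integral_dt_eq0 m (h : R * 'rV[R]_m -> R) M : 0 < M ->
  (forall p, derivable h p (1, 0)) -> continuous ('D_(1, 0) h) ->
  (forall p, ~ closed_box 0 M p -> h p = 0 /\ 'D_(1, 0) h p = 0) ->
  (\int[lebST m]_p ('D_(1, 0) h p)%:E = 0)%E.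
Proof.
move=> M0 dh ch h0.
rewrite -(integral21_prod_meas1 (integrable_derive ch _ (M := M))); last first.
  by move=> p /h0[].
rewrite integral0_eq// => v _; rewrite /fubini_G/=.
have AE x k : (k *: (1 : R) + x, v) = k *: ((1, 0) : R * 'rV[R]_m) + (x, v).
  by apply/pair_equal_spec; split => //=; rewrite scaler0 add0r.
pose hv (x : R) := h (x, v).
have De x : 'D_1 hv x = 'D_(1, 0) h (x, v).
  exact: (derive_affine h (A := fun y => (y, v)) (AE x)).
under eq_integral do rewrite -De.
have out x : x \notin `[- M, M] -> ~ closed_box 0 M (x, v).
  by move=> /negP xM [/= +]; rewrite sub0r add0r.
apply: (@integral_derive1_eq0 hv (- M) M); first lra.
- move=> x; exact: (derivable_affine (A := fun y => (y, v)) (AE x)).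
- have -> : 'D_1 hv = (fun x => 'D_(1, 0) h (x, v)) by exact/funext.
  move=> x; apply: (@continuous_comp _ _ _ (fun x => (x, v)) ('D_(1, 0) h)).
    exact: cvg_pair cvg_id (cvg_cst _).
  exact: ch.
- by move=> x /out /h0[].
- by move=> x /out /h0[]; rewrite De.
Qed.

Lemma continuous_rV_cons n : continuous (@rV_cons R n).
Proof.
move=> p; apply/cvg_ballP => e e0; near=> q.
have [pq1 [_ pq2]] : ball p e q by near: q; exact: (nbhsx_ballx p e e0).
split=> // i j; rewrite ord1.
by case: (unliftP ord0 j) => [k|] ->; rewrite ?rV_consS ?rV_cons0.
Unshelve. all: by end_near. Qed.

Lemma rV_cons_affine n (w p : R * 'rV[R]_n) (k : R) :
  rV_cons (k *: w + p) = k *: rV_cons w + rV_cons p.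
Proof.
apply/rowP => j; rewrite [in RHS]mxE [X in _ = X + _]mxE.
by case: (unliftP ord0 j) => [i|] ->; rewrite ?rV_consS ?rV_cons0 ?mxE.
Qed.

Lemma rV_cons_edir n (o : option 'I_n) :
  rV_cons (edir o) = delta_mx ord0 (if o is Some i then lift ord0 i else ord0).
Proof.
apply/rowP => j; rewrite [RHS]mxE eqxx/=.
case: o => [i|]; case: (unliftP ord0 j) => [k|] ->;
  by rewrite ?rV_consS ?rV_cons0/= ?mxE ?eqxx//=.
Qed.

(** Fubini's theorem with space as the inner variable; the hypothesis on the
    slices is the statement proved by induction in [integral_dx_eq0]. *)
Lemma integral_dx_slices m (i : 'I_m) (g : R * 'rV[R]_m -> R) M :
  (forall h : 'rV[R]_m -> R,
    (forall v, derivable h v (delta_mx ord0 i)) ->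
    continuous ('D_(delta_mx ord0 i) h) ->
    (forall v : 'rV[R]_m, ~ (forall j, v ord0 j \in `[- M, M]) ->
      h v = 0 /\ 'D_(delta_mx ord0 i) h v = 0) ->
    (\int[lebesgue_rV m]_v ('D_(delta_mx ord0 i) h v)%:E = 0)%E) ->
  (forall p, derivable g p (0, delta_mx ord0 i)) ->
  continuous ('D_(0, delta_mx ord0 i) g) ->
  (forall p, ~ closed_box 0 M p ->
    g p = 0 /\ 'D_(0, delta_mx ord0 i) g p = 0) ->
  (\int[lebST m]_p ('D_(0, delta_mx ord0 i) g p)%:E = 0)%E.
Proof.
move=> J dg cg g0.
have slice (x : R) :
    (\int[lebesgue_rV m]_v ('D_(0, delta_mx ord0 i) g (x, v))%:E = 0)%E.
  have AE v k : (x, k *: delta_mx ord0 i + v) =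
      k *: ((0, delta_mx ord0 i) : R * 'rV[R]_m) + (x, v).
    by apply/pair_equal_spec; split => //=; rewrite scaler0 add0r.
  pose gx (v : 'rV[R]_m) := g (x, v).
  have De v : 'D_(delta_mx ord0 i) gx v = 'D_(0, delta_mx ord0 i) g (x, v).
    exact: (derive_affine g (A := fun v => (x, v)) (AE v)).
  under eq_integral do rewrite -De.
  have out (v : 'rV[R]_m) : ~ (forall j, v ord0 j \in `[- M, M]) -> ~ closed_box 0 M (x, v).
    move=> vM [_ /= H]; apply: vM => j; have := H j.
    by rewrite mxE sub0r add0r.
  apply: J.
  - move=> v; exact: (derivable_affine (A := fun v => (x, v)) (AE v)).
  - have -> : 'D_(delta_mx ord0 i) gx =
        (fun v => 'D_(0, delta_mx ord0 i) g (x, v)) by exact/funext.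
    move=> v; apply: (@continuous_comp _ _ _ (fun v => (x, v))
      ('D_(0, delta_mx ord0 i) g)).
      exact: continuous_pairr.
    exact: cg.
  - by move=> v /out /g0; rewrite De.
rewrite -(integral12_prod_meas1 (integrable_derive cg _ (M := M))); last first.
  by move=> p /g0[].
by rewrite integral0_eq// => x _; exact: slice.
Qed.

(** Induction on the dimension. Through [rV_cons] the first coordinate becomes
    the time of a space-time of one dimension less, and the other coordinates
    its space. *)
Lemma integral_dx_eq0 m (i : 'I_m) (h : 'rV[R]_m -> R) M : 0 < M ->
  (forall v, derivable h v (delta_mx ord0 i)) ->
  continuous ('D_(delta_mx ord0 i) h) ->
  (forall v : 'rV[R]_m, ~ (forall j, v ord0 j \in `[- M, M]) ->
    h v = 0 /\ 'D_(delta_mx ord0 i) h v = 0) ->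
  (\int[lebesgue_rV m]_v ('D_(delta_mx ord0 i) h v)%:E = 0)%E.
Proof.
move=> M0; elim: m i h => [[]//|m IH] i h dh ch h0.
pose g p := h (rV_cons p).
have [b bE] : exists b : option 'I_m,
    i = if b is Some j then lift ord0 j else ord0.
  by case: (unliftP ord0 i) => [j|] ->; [exists (Some j)|exists None].
have AE p k : rV_cons (k *: edir b + p) =
    k *: delta_mx ord0 i + rV_cons p :> 'rV[R]_m.+1.
  by rewrite rV_cons_affine rV_cons_edir -bE.
have Dg p : 'D_(edir b) g p = 'D_(delta_mx ord0 i) h (rV_cons p).
  exact: (derive_affine h (AE p)).
have dg p : derivable g p (edir b) by exact: (derivable_affine (AE p)).
have cg : continuous ('D_(edir b) g).
  have -> : 'D_(edir b) g = 'D_(delta_mx ord0 i) h \o @rV_cons R m.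
    exact/funext.
  by move=> p; apply: continuous_comp; [exact: continuous_rV_cons|exact: ch].
have g0 p : ~ closed_box 0 M p -> g p = 0 /\ 'D_(edir b) g p = 0.
  rewrite Dg => pM; apply: h0 => pM'; apply: pM; split => /=.
    by have := pM' ord0; rewrite rV_cons0 sub0r add0r.
  by move=> j; have := pM' (lift ord0 j); rewrite rV_consS mxE sub0r add0r.
rewrite integral_rV_cons; last 2 first.
- exact: measurable_rV_continuous.
- rewrite (_ : _ \o @rV_cons R m = 'D_(edir b) g); last exact/esym/funext.
  by apply: (integrable_derive cg (M := M)) => p /g0[].
under eq_integral do rewrite -Dg.
case: b {bE AE Dg} dg cg g0 => [j|] dg cg g0; last exact: integral_dt_eq0 g0.
apply: integral_dx_slices g0 => // h' dh' ch' h0'.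
exact: IH.
Qed.

Lemma integral_derive_eq0 n (o : option 'I_n) (g : R * 'rV[R]_n -> R) M :
  0 < M ->
  (forall p, derivable g p (edir o)) -> continuous ('D_(edir o) g) ->
  (forall p, ~ closed_box 0 M p -> g p = 0 /\ 'D_(edir o) g p = 0) ->
  (\int[lebST n]_p ('D_(edir o) g p)%:E = 0)%E.
Proof.
move=> M0; case: o => [i|] dg cg g0; last exact: integral_dt_eq0 g0.
apply: integral_dx_slices g0 => // h dh ch h0.
exact: integral_dx_eq0 h0.
Qed.

End parts.

(** * The fundamental lemma of the calculus of variations *)

Lemma open_setI_gt0 (R : realType) (V : normedModType R) (U : set V)
    (f : V -> R) :
  open U -> (forall x, U x -> {for x, continuous f}) ->
  open (U `&` [set x | 0 < f x]).
Proof.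
move=> oU cf; rewrite openE => x [Ux fx]; apply: filterI.
  exact: open_nbhs_nbhs.
exact: (cvgr_gt (f x) (cf x Ux) 0 fx).
Qed.

Section fundamental_lemma.
Context {R : realType} {d : nat}.
Local Notation spacetime := (R * 'rV[R]_d)%type.
Local Notation mu := (@lebesgue_spacetime R d).
Implicit Types (c p : spacetime) (r : R).

Lemma measurable_box c r :
  measurable (closed_box c r : set (measurableTypeR R * 'rV[R]_d)).
Proof. exact: measurable_closed_box. Qed.

Lemma closed_box_mono c r r' : r' <= r -> closed_box c r' `<=` closed_box c r.
Proof.
move=> rr p [/= p1 p2]; split => /=; last move=> i; move: p1 (p2);
  [move=> + _|move=> _ /(_ i)]; rewrite !in_itv/= => /andP[? ?];
  apply/andP; split; lra.
Qed.

Lemma closed_box_center c r : 0 < r -> closed_box c r c.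
Proof.
by move=> r0; split=> [|i] /=; rewrite in_itv/=; apply/andP; split; lra.
Qed.

Lemma Rintegral_box_gt0 (U : set spacetime) (f : spacetime -> R) c r :
  0 < r -> open U -> closed_box c r `<=` U ->
  (forall p, U p -> {for p, continuous f}) ->
  (forall p, closed_box c r p -> 0 <= f p) -> 0 < f c ->
  0 < \int[mu]_(p in closed_box c r) f p.
Proof.
move=> r0 oU KU cf f0 fc.
have Uc : U c by apply/KU/closed_box_center.
have [r' r'0 fr'] : exists2 r', 0 < r' & forall p, closed_box c r' p -> f c / 2 < f p.
  have /cvgrPdist_lt/(_ (f c / 2)) : f p @[p --> c] --> f c := cf _ Uc.
  rewrite divr_gt0// => /(_ isT) /nbhs_ballP[e /= e0 eP].
  exists (e / 2); first by rewrite divr_gt0.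
  move=> p /(@closed_box_ball _ _ c (e / 2) e) cp.
  have /eP : ball c e p by apply: cp; rewrite ?divr_gt0//; lra.
  by rewrite /= ltr_norml => /andP[? ?]; lra.
pose s := Num.min r r'.
have s0 : 0 < s by rewrite lt_min r0.
have sr : closed_box c s `<=` closed_box c r.
  by apply: closed_box_mono; rewrite ge_min lexx.
have sr' : closed_box c s `<=` closed_box c r'.
  by apply: closed_box_mono; rewrite ge_min lexx orbT.
have mK := measurable_box c r.
have mK' := measurable_box c s.
have iK : mu.-integrable (closed_box c r) (EFin \o f).
  exact: (integrable_closed_box oU).
apply: fine_gt0; apply/andP; split; last first.
  by have /integrable_lty := iK; exact.
apply: (@lt_le_trans _ _ (\int[mu]_(p in closed_box c s) (f c / 2)%:E)%E).
  rewrite integral_cst//; apply: mule_gt0; first by rewrite lte_fin divr_gt0.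
  exact: closed_box_measure_gt0.
apply: (@le_trans _ _ (\int[mu]_(p in closed_box c s) (f p)%:E)%E).
  apply: ge0_le_integral => //.
  - by move=> p _; rewrite lee_fin divr_ge0// ltW.
  - by have /integrableP[] := integrableS mK mK' sr iK.
  - by move=> p /sr' /fr' /ltW; rewrite lee_fin.
apply: ge0_subset_integral => //.
- by have /integrableP[] := iK.
Qed.

(** Near a point outside the box the product is zero, whatever [f] is there. *)
Lemma smooth_localize (U : set spacetime) (f psi : spacetime -> R) c r :
  open U -> closed_box c r `<=` U -> smooth U f -> smooth setT psi ->
  (forall p, ~ closed_box c r p -> psi p = 0) ->
  smooth setT (fun p => f p * psi p).
Proof.
move=> oU KU Cf Cpsi psi0.
have oK : open (~` closed_box c r) by exact/closed_openC/closed_box_closed.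
have -> : setT = U `|` ~` closed_box c r.
  apply/seteqP; split => // p _.
  by have [/KU|] := pselect (closed_box c r p); [left|right].
move=> k; apply: Ck_setU.
  by apply: (smooth_mul oU Cf); apply: smooth_subset Cpsi.
apply: (@smooth_eq _ _ _ oK _ (fun=> 0)); last exact: smooth_cst.
by move=> p /= /psi0 ->; rewrite mulr0.
Qed.

Lemma derive_outside (g : spacetime -> R) (K : set spacetime) v p :
  closed K -> (forall q, ~ K q -> g q = 0) -> ~ K p -> 'D_v g p = 0.
Proof.
move=> cK g0 Kp; rewrite (@near_eq_derive _ _ _ _ (cst 0)) ?derive_cst//.
have oK : open (~` K) by exact: closed_openC.
exact: (open_near oK Kp).
Qed.

Lemma Rintegral_derive_eq0 (o : option 'I_d) (g : spacetime -> R) c r :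
  0 < r -> smooth setT g -> (forall p, ~ closed_box c r p -> g p = 0) ->
  \int[mu]_(p in closed_box c r) 'D_(edir o) g p = 0.
Proof.
move=> r0 Cg g0.
have D0 p : ~ closed_box c r p -> 'D_(edir o) g p = 0.
  exact: (derive_outside _ (@closed_box_closed _ _ c r) g0).
pose M := `|c.1| + \sum_i `|c.2 ord0 i| + r.
have s0 : 0 <= \sum_i `|c.2 ord0 i| by exact: sumr_ge0.
have cM : closed_box c r `<=` closed_box 0 M.
  have itvM (x y : R) : `|y| <= M - r -> x \in `[y - r, y + r] ->
      x \in `[- M, M].
    rewrite ler_norml !in_itv/= => /andP[? ?] /andP[? ?].
    by apply/andP; split; lra.
  move=> p [/= p1 p2]; split => [|i] /=.
    by rewrite sub0r add0r; apply: itvM p1; rewrite /M addrK lerDl.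
  rewrite mxE sub0r add0r; apply: itvM (p2 i); rewrite /M addrK (bigD1 i)//=.
  by rewrite addrCA lerDl addr_ge0// sumr_ge0.
rewrite /Rintegral (@integral_support _ _ _ mu); last by move=> p /D0 /= ->.
rewrite (@integral_derive_eq0 _ _ o g M)//.
- by rewrite /M ltr_wpDl// addr_ge0.
- by move=> p; apply/diff_derivable/(smooth_diff Cg).
- by move=> p; exact: (smooth_cont (smooth_D _ Cg)).
- by move=> p /(contra_not (@cM p)) pM; split; [exact: g0|exact: D0].
Qed.

(** The fundamental lemma of the calculus of variations in divergence form.
    Integration by parts turns the integrand into [e * psi], with [e] the
    difference of the two sides and [psi] the mollifier. If [e] were nonzero at
    a point, a mollifier supported where [e] keeps its sign would give a nonzero
    integral. *)
Lemma weak_to_strong (U : set spacetime) (A B0 : spacetime -> R)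
    (B : 'I_d -> spacetime -> R) :
  open U -> smooth U A -> smooth U B0 -> (forall i, smooth U (B i)) ->
  (forall c r, 0 < r -> closed_box c r `<=` U ->
    \int[mu]_(p in closed_box c r)
      (A p * mollifier c r p + B0 p * dt (mollifier c r) p
       + \sum_i B i p * dx i (mollifier c r) p) = 0) ->
  forall p, U p -> A p = dt B0 p + \sum_i dx i (B i) p.
Proof.
move=> oU CA CB0 CB weak.
pose e p := A p - (dt B0 p + \sum_i dx i (B i) p).
have Ce : smooth U e.
  apply: smooth_sub => //; apply: smooth_add => //; first exact: smooth_D.
  by apply: smooth_sum => // i; exact: smooth_D.
have int0 c r : 0 < r -> closed_box c r `<=` U ->
    \int[mu]_(p in closed_box c r) (e p * mollifier c r p) = 0.
  move=> r0 KU; set K := closed_box c r; set psi := mollifier c r.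
  have Cpsi : smooth setT psi by exact: smooth_mollifier.
  have CpsiU : smooth U psi by apply: smooth_subset Cpsi.
  have psi0 p : ~ K p -> psi p = 0.
    exact: mollifier_outside.
  have loc (f : spacetime -> R) : smooth U f -> smooth setT (fun p => f p * psi p).
    by move=> Cf; apply: (smooth_localize oU KU).
  have loc0 (f : spacetime -> R) p : ~ K p -> f p * psi p = 0.
    by move=> /psi0 ->; rewrite mulr0.
  have mK := measurable_box c r.
  have iK (f : spacetime -> R) : smooth U f -> mu.-integrable K (EFin \o f).
    by move=> Cf; apply: (integrable_closed_box oU) => // p; exact: smooth_cont.
  have D0 (f : spacetime -> R) (o : option 'I_d) : smooth U f ->
      \int[mu]_(p in K) 'D_(edir o) (fun p => f p * psi p) p = 0.
    by move=> Cf; apply: Rintegral_derive_eq0 => //; [exact: loc|exact: loc0].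
  have CD (f : spacetime -> R) (o : option 'I_d) : smooth U f ->
      smooth U ('D_(edir o) (fun p => f p * psi p)).
    by move=> Cf; apply: smooth_D; exact: smooth_mul.
  have Dmul (f : spacetime -> R) (o : option 'I_d) p : smooth U f -> U p ->
      'D_(edir o) (fun p => f p * psi p) p =
      'D_(edir o) f p * psi p + f p * 'D_(edir o) psi p.
    by move=> Cf Up; rewrite D_mul//; exact: smooth_diff Up.
  have Dsum0 n (f : 'I_n -> 'I_d) : \int[mu]_(p in K)
      (\sum_i dx (f i) (fun p => B (f i) p * psi p) p) = 0.
    elim: n f => [|n IH] f.
      under eq_Rintegral do rewrite big_ord0.
      by rewrite Rintegral_cst// mul0r.
    under eq_Rintegral do rewrite big_ord_recl.
    rewrite RintegralD//.
    - by rewrite IH (D0 _ (Some (f ord0)))// addr0.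
    - by apply: iK; exact: (CD _ (Some (f ord0))).
    - by apply: iK; apply: smooth_sum => // i; exact: (CD _ (Some _)).
  rewrite -[RHS](weak c r r0 KU).
  have -> : \int[mu]_(p in K) (A p * psi p + B0 p * dt psi p +
        \sum_i B i p * dx i psi p) =
      \int[mu]_(p in K) ((e p * psi p + dt (fun p => B0 p * psi p) p) +
        \sum_i dx i (fun p => B i p * psi p) p).
    apply: eq_Rintegral => p; rewrite inE => /KU Up.
    have -> : dt (fun p => B0 p * psi p) p = dt B0 p * psi p + B0 p * dt psi p.
      exact: (Dmul B0 None).
    have -> : \sum_i dx i (fun p => B i p * psi p) p =
        \sum_i (dx i (B i) p * psi p + B i p * dx i psi p).
      by apply: eq_bigr => i _; exact: (Dmul (B i) (Some i)).
    by rewrite big_split/= -mulr_suml /e; ring.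
  have ie : smooth U (fun p => e p * psi p) by exact: smooth_mul.
  have it : smooth U (dt (fun p => B0 p * psi p)) by exact: (CD _ None).
  rewrite RintegralD//.
  - rewrite (Dsum0 d id) addr0 RintegralD//; [|exact: iK|exact: iK].
    by rewrite (D0 _ None)// addr0.
  - by apply: iK; exact: smooth_add.
  - by apply: iK; apply: smooth_sum => // i; exact: (CD _ (Some _)).
(* Both signs of [e] are excluded at once, with [s = 1] and [s = -1]. *)
suff main s : forall p, U p -> s * e p <= 0.
  move=> p Up; apply/eqP; rewrite -subr_eq0 -/(e p) eq_le.
  have := main 1 p Up; have := main (-1) p Up.
  by rewrite mul1r mulN1r oppr_le0 => -> ->.
move=> c Uc; rewrite leNgt; apply/negP => ec.
pose V := U `&` [set p | 0 < s * e p].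
have Cse : smooth U (fun p => s * e p).
  by apply: smooth_mul => //; exact: smooth_cst.
have oV : open V.
  by apply: open_setI_gt0 => // p; exact: smooth_cont.
have [r r0 KV] : exists2 r, 0 < r & closed_box c r `<=` V.
  by apply: closed_box_sub.
have KU : closed_box c r `<=` U by move=> p /KV[].
have : 0 < \int[mu]_(p in closed_box c r) (s * (e p * mollifier c r p)).
  apply: (@Rintegral_box_gt0 U) => //.
  - move=> p; apply: smooth_cont; apply: smooth_mul => //.
      exact: smooth_cst.
    apply: smooth_mul => //; apply: smooth_subset (smooth_mollifier c r) => //.
  - move=> p /KV[_ /= ep]; rewrite mulrA mulr_ge0 ?mollifier_ge0// ltW//.
  - by rewrite mulrA mulr_gt0// mollifier_gt0.
rewrite RintegralZl ?int0 ?mulr0 ?ltxx//.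
  exact: measurable_box.
apply: (integrable_closed_box oU) => // p; apply: smooth_cont.
by apply: smooth_mul => //; apply: smooth_subset (smooth_mollifier c r).
Qed.

End fundamental_lemma.

(** * Differentiation of the action *)

Section first_variation.
Context {R : realType} {d : nat}.
Local Notation spacetime := (R * 'rV[R]_d)%type.
Local Notation mu := (@lebesgue_spacetime R d).
Implicit Types (c p : spacetime) (r s : R).

(** Compactness of the box makes the range of [s] uniform in [p]. The bound
    exceeds [`|H|] at [s = 0] by a margin, so it persists for small [s]. *)
Lemma near_box_bound (Q : set (R * spacetime)) (H : R * spacetime -> R) c r :
  open Q -> (forall z, Q z -> {for z, continuous H}) ->
  (forall p, closed_box c r p -> Q (0, p)) ->
  exists M, \forall s \near 0, forall p, closed_box c r p ->
    Q (s, p) /\ `|H (s, p)| <= M.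
Proof.
move=> oQ cH KQ.
have cK := @closed_box_compact R d c r.
have [M [_ HM]] : bounded_set ((fun p => H (0, p)) @` closed_box c r).
  apply: compact_bounded; apply: continuous_compact => //.
  apply: continuous_in_subspaceT => p; rewrite inE => Kp.
  apply: (@continuous_comp _ _ _ (fun p => (0, p)) H).
    exact: continuous_pairr.
  exact/cH/KQ.
exists (M + 2).
have /compact_near_coveringP ncK := cK.
apply: (ncK R (nbhs (0 : R)) (fun s p => Q (s, p) /\ `|H (s, p)| <= M + 2)).
move=> p Kp.
have cHp := cH _ (KQ p Kp).
have : \forall z \near (0 : R, p), Q z /\ `|H z| <= M + 2.
  near=> z; split; first by near: z; apply: open_nbhs_nbhs; split => //; exact: KQ.
  have : `|H (0, p) - H z| < 1.
    by near: z; move/cvgrPdist_lt : cHp; apply.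
  have : `|H (0, p)| <= M + 1 by apply: (HM (M + 1)); [lra|exists p].
  have := ler_normB (H (0, p)) (H (0, p) - H z).
  rewrite opprB addrCA subrr addr0; lra.
move=> [[A B] /= [nA nB] AB]; exists (B, A) => // -[p' s] /= [Bp As].
exact: (AB (s, p')).
Unshelve. all: by end_near. Qed.

(** The variation is confined to the box, so the difference quotients of the
    integral are integrals over the box of those of [G]. By the mean value
    theorem they are bounded uniformly, and dominated convergence along
    [S n = e / (2 (n + 1))] identifies their limit, which stationarity makes
    zero. *)
Lemma first_variation (D : set spacetime) (L : R -> spacetime -> R)
    (Q : set (R * spacetime)) (G : R * spacetime -> R) c r :
  measurable (D : set (measurableTypeR R * 'rV[R]_d)) ->
  open Q -> smooth Q G ->
  closed_box c r `<=` D -> (forall p, closed_box c r p -> Q (0, p)) ->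
  (forall s p, closed_box c r p -> L s p = G (s, p)) ->
  (forall s p, D p -> ~ closed_box c r p -> L s p = L 0 p) ->
  mu.-integrable D (EFin \o L 0) ->
  stationary (fun s => \int[mu]_(p in D) L s p) ->
  \int[mu]_(p in closed_box c r) 'D_(1, 0) G (0, p) = 0.
Proof.
move=> mD oQ CG KD KQ LG Lout iL0 [dF F0].
set K := closed_box c r; set F := fun s => _ in dF F0.
have mK := measurable_box c r.
pose G' := 'D_((1, 0) : R * spacetime) G.
have CG' : smooth Q G' by exact: smooth_D.
have [M nM] := near_box_bound oQ (fun z => @smooth_cont _ _ Q _ _ z CG') KQ.
have [e /= e0 eM] := nM.
have KM s p : 0 <= s < e -> K p -> Q (s, p) /\ `|G' (s, p)| <= M.
  by move=> /andP[s0 se] Kp; apply: eM => //=; rewrite sub0r normrN ger0_norm.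
pose S n : R := e / 2 / n.+1%:R.
have S0 n : 0 < S n by rewrite divr_gt0// divr_gt0.
have Se n : S n < e.
  rewrite /S ltr_pdivrMr//; apply: (@lt_le_trans _ _ e); first lra.
  by rewrite ler_peMr ?ler1n// ltW.
have Scvg : S n @[n --> \oo] --> 0^'.
  have S_0 : S n @[n --> \oo] --> 0.
    rewrite -(mulr0 (e / 2)); apply: cvgM; first exact: cvg_cst.
    exact: cvg_harmonic.
  move=> A /S_0 nA.
  have {}nA : \forall n \near \oo, S n != 0 -> A (S n) := nA.
  by apply: filterS nA => n; apply; rewrite gt_eqF.
have lineE s p : (0, p) + s *: ((1, 0) : R * spacetime) = (s, p).
  apply/pair_equal_spec; split => /=; first by rewrite add0r [_ *: _]mulr1.
  by rewrite scaler0 addr0.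
have quot s p : 0 < s < e -> K p -> `|G (s, p) - G (0, p)| <= s * M.
  move=> /andP[s0 se] Kp.
  have se' x : 0 <= x <= s -> 0 <= x < e.
    by move=> /andP[-> xs]; exact: le_lt_trans se.
  have : exists2 x, 0 <= x <= s & G ((0, p) + s *: ((1, 0) : R * spacetime)) -
      G (0, p) = s * G' ((0, p) + x *: ((1, 0) : R * spacetime)).
    apply: (@MVT_line R (R * spacetime)%type G (0, p) (1, 0) s s0) => x /se' xe.
    by rewrite lineE; apply: (smooth_diff CG); have [] := KM _ _ xe Kp.
  move=> [x /se' xe]; rewrite !lineE => ->.
  rewrite normrM gtr0_norm//; apply: ler_wpM2l; first exact: ltW.
  exact: (KM _ _ xe Kp).2.
have cont (H : R * spacetime -> R) s : 0 <= s < e -> smooth Q H ->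
    measurable_fun (K : set (measurableTypeR R * 'rV[R]_d)) (fun p => H (s, p)).
  move=> se CH; have cs : continuous (fun p : spacetime => (s, p)).
    exact: continuous_pairr.
  apply: (@measurable_spacetime_continuous R d K [set p | Q (s, p)]).
  - by apply: (@open_comp _ _ (fun p => (s, p)) Q) => // p _; exact: cs.
  - exact: measurable_closed_box.
  - by move=> p Kp /=; have [] := KM _ _ se Kp.
  - move=> p Qp; apply: (@continuous_comp _ _ _ (fun p => (s, p)) H).
      exact: cs.
    exact: (smooth_cont CH Qp).
have e00 : 0 <= (0 : R) < e by rewrite lexx.
have eS n : 0 < S n < e by rewrite S0 Se.
have eS' n : 0 <= S n < e by rewrite ltW// Se.
pose g n p := (S n)^-1 * (L (S n) p - L 0 p).
have gE n p : K p -> g n p = (S n)^-1 * (G (S n, p) - G (0, p)).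
  by move=> Kp; rewrite /g !LG.
have g_le n p : K p -> `|g n p| <= M.
  move=> Kp; rewrite gE// normrM [X in X * _]gtr0_norm ?invr_gt0//.
  by rewrite ler_pdivrMl//; exact: quot.
have mg n : measurable_fun (K : set (measurableTypeR R * 'rV[R]_d)) (g n).
  apply: (@eq_measurable_fun _ _ _ _ _
      (fun p => (S n)^-1 * (G (S n, p) - G (0, p)))).
    by move=> p; rewrite inE => Kp; rewrite gE.
  apply: measurable_funM; first exact: measurable_cst.
  by apply: measurable_funB; exact: cont.
have Mfin : (mu K < +oo)%E by exact: closed_box_finite.
have iM : mu.-integrable K (EFin \o cst M).
  by apply: measurable_bounded_integrable => //; exact: bounded_cst.
have ig n : mu.-integrable K (EFin \o g n).
  apply: (le_integrable mK _ _ iM); first exact/measurable_EFinP.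
  by move=> p Kp /=; rewrite lee_fin (le_trans (g_le _ _ Kp))// ler_norm.
have Fg n : (S n)^-1 * (F (S n) - F 0) = \int[mu]_(p in K) g n p.
  pose Dl p := L (S n) p - L 0 p.
  have iDl : mu.-integrable K (EFin \o Dl).
    have := integrableZl mK (S n) (ig n); apply: eq_integrable => // p _ /=.
    by rewrite -EFinM /g mulrA mulfV ?mul1r// gt_eqF.
  have iDK : mu.-integrable D (EFin \o (Dl \_ K)).
    have /(integrable_mkcond _ mK) := iDl; rewrite restrict_EFin.
    exact: integrableS.
  have -> : F (S n) = \int[mu]_(p in D) (L 0 p + (Dl \_ K) p).
    apply: eq_Rintegral => p; rewrite inE => Dp; rewrite patchE.
    case: ifPn => [_|/negP]; first by rewrite /Dl addrC subrK.
    by rewrite inE => Kp; rewrite addr0 Lout.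
  rewrite RintegralD// addrAC subrr add0r -Rintegral_mkcondr setIidr//.
  by rewrite RintegralZl.
have lim1 : \int[mu]_(p in K) g n p @[n --> \oo] --> (0 : R).
  have : (h^-1 *: ((F \o shift 0) (h *: (1 : R)) - F 0)) @[h --> 0^'] --> 'D_1 F 0.
    exact: dF.
  rewrite F0 =>  /(cvg_comp _ _ Scvg); apply: cvg_trans; apply: near_eq_cvg.
  by apply: nearW => n /=; rewrite -Fg addr0 [_ *: 1]mulr1.
have lim2 : \int[mu]_(p in K) g n p @[n --> \oo] --> \int[mu]_(p in K) G' (0, p).
  have [] := @dominated_convergence _ _ R mu K mK (fun n p => (g n p)%:E)
    (fun p => (G' (0, p))%:E) (fun p => M%:E) _ _ _ iM _.
  - by move=> n; exact/measurable_EFinP.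
  - apply/measurable_EFinP; exact: (cont G' 0 e00 CG').
  - apply: aeW => p Kp; apply: cvg_EFin; first exact: nearW.
    have dG : derivable G (0, p) (1, 0).
      by apply/diff_derivable/(smooth_diff CG); exact: KQ.
    have : (h^-1 *: ((G \o shift (0, p)) (h *: ((1, 0) : R * spacetime)) -
        G (0, p))) @[h --> 0^'] --> G' (0, p) by exact: dG.
    move=> /(cvg_comp _ _ Scvg); apply: cvg_trans; apply: near_eq_cvg.
    by apply: nearW => n /=; rewrite gE// (addrC (S n *: _)) lineE.
  - by apply: aeW => p n Kp /=; rewrite lee_fin g_le.
  move=> iG' _ lim; apply: fine_cvg; rewrite fineK//.
  exact: integrable_fin_num.
exact: (cvg_unique _ lim2 lim1).
Qed.

End first_variation.

(** * First variation of the Lagrangian *)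

Section jet_lagrangian.
Context {R : realType} {d : nat}.
Local Notation spacetime := (R * 'rV[R]_d)%type.
Local Notation mu := (@lebesgue_spacetime R d).
Variables (alpha : R -> R) (eps : R * R -> R).

(** The Lagrangian as a function of the values at one point of the density, the
    velocity and the time and space derivatives of [phi]. Variations of [phi]
    and of the motion both perturb these values linearly in [s], so a single
    first variation formula covers them. *)
Definition jet_lagrangian (r : R) (v : 'I_d -> R) (ft : R) (g : 'I_d -> R) : R :=
  2^-1 * r * (\sum_i v i * v i) - 2^-1 * alpha r * (\sum_i g i * g i)
  - r * eps (r, ft + \sum_i v i * g i).

Lemma lagrangianE rho u phi (p : spacetime) :
  lagrangian alpha eps rho u phi p =
  jet_lagrangian (rho p) (u p ord0) (dt phi p) (fun i => dx i phi p).
Proof.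
rewrite /lagrangian /jet_lagrangian /material_dt /dotv.
congr (_ - _ * _ - _ * eps (_, _ + _)).
  by apply: eq_bigr => i _; rewrite !mxE.
by apply: eq_bigr => i _; rewrite !mxE.
Qed.

(** The derivative of [jet_lagrangian] in the direction [(dr, dv, dft, dg)]. *)
Definition jet_variation (r : R) (v : 'I_d -> R) (ft : R) (g : 'I_d -> R)
    (dr : R) (dv : 'I_d -> R) (dft : R) (dg : 'I_d -> R) : R :=
  dr * (2^-1 * (\sum_i v i * v i)
    - 2^-1 * 'D_1 alpha r * (\sum_i g i * g i)
    - eps (r, ft + \sum_i v i * g i)
    - r * 'D_(1, 0) eps (r, ft + \sum_i v i * g i))
  + r * (\sum_i v i * dv i) - alpha r * (\sum_i g i * dg i)
  - r * 'D_(0, 1) eps (r, ft + \sum_i v i * g i) *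
    (dft + \sum_i (dv i * g i + v i * dg i)).

Hypothesis alpha_smooth : smooth [set r : R | 0 < r] alpha.
Hypothesis eps_smooth : smooth [set q : R * R | 0 < q.1] eps.

Lemma derive_jet_lagrangian r v ft g dr dv dft dg : 0 < r ->
  'D_1 (fun s : R => jet_lagrangian (r + s * dr) (fun i => v i + s * dv i)
    (ft + s * dft) (fun i => g i + s * dg i)) 0 =
  jet_variation r v ft g dr dv dft dg.
Proof.
move=> r0.
have Did : has_D (fun s : R => s) (0 : R) 1 1.
  by split; [exact: ex_diff|exact: derive_id].
have Da (a b : R) : has_D (fun s : R => a + s * b) (0 : R) 1 b.
  have := has_D_add (has_D_cst a (0 : R) (1 : R))
    (has_D_mul Did
      (has_D_cst b (0 : R) (1 : R))).
  by rewrite mulr0 addr0 add0r mul1r.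
have Ds (a b a' b' : 'I_d -> R) := has_D_sum (fun i =>
  has_D_mul (Da (a i) (a' i)) (Da (b i) (b' i))).
have Dalpha := has_D_comp1 (Da r dr) (h := alpha).
have Deps := has_D_comp2 (Da r dr) (has_D_add (Da ft dft) (Ds v g dv dg)) (h := eps).
have dalpha : differentiable alpha (r + 0 * dr).
  by apply: (smooth_diff alpha_smooth); rewrite /= mul0r addr0.
have deps w : differentiable eps (r + 0 * dr, w).
  by apply: (smooth_diff eps_smooth); rewrite /= mul0r addr0.
have [_ ->] := has_D_sub (has_D_sub
  (has_D_mul (has_D_cmul 2^-1 (Da r dr)) (Ds v v dv dv))
  (has_D_mul (has_D_cmul 2^-1 (Dalpha dalpha)) (Ds g g dg dg)))
  (has_D_mul (Da r dr) (Deps (deps _))).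
rewrite /jet_variation !mul0r !addr0.
have Esum (a b a' b' : 'I_d -> R) : \sum_i (a i + 0 * a' i) * (b i + 0 * b' i) =
    \sum_i a i * b i.
  by apply: eq_bigr => i _; rewrite !mul0r !addr0.
have Esum' (a b a' b' : 'I_d -> R) :
    \sum_i (a' i * (b i + 0 * b' i) + (a i + 0 * a' i) * b' i) =
    \sum_i (a' i * b i + a i * b' i).
  by apply: eq_bigr => i _; rewrite !mul0r !addr0.
have Ediag (a a' : 'I_d -> R) : \sum_i (a' i * a i + a i * a' i) =
    2 * \sum_i a i * a' i.
  by rewrite mulr_sumr; apply: eq_bigr => i _; ring.
by rewrite !Esum !Esum' !Ediag; field.
Qed.

Lemma smooth_jet_lagrangian (V : normedModType R) (Q : set V)
    (r : V -> R) (v : 'I_d -> V -> R) (ft : V -> R) (g : 'I_d -> V -> R) :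
  open Q -> (forall z, Q z -> 0 < r z) ->
  smooth Q r -> (forall i, smooth Q (v i)) -> smooth Q ft ->
  (forall i, smooth Q (g i)) ->
  smooth Q (fun z => jet_lagrangian (r z) (v ^~ z) (ft z) (g ^~ z)).
Proof.
move=> oQ r0 Cr Cv Cft Cg.
have C2 : smooth Q (fun=> 2^-1 : R) by exact: smooth_cst.
have Csum (a b : 'I_d -> V -> R) : (forall i, smooth Q (a i)) ->
    (forall i, smooth Q (b i)) -> smooth Q (fun z => \sum_i a i z * b i z).
  by move=> Ca Cb; apply: smooth_sum => // i; exact: smooth_mul.
apply: smooth_sub => //.
  apply: smooth_sub => //; apply: smooth_mul => //; try exact: Csum.
    exact: smooth_mul.
  by apply: smooth_mul => //; apply: (smooth_comp1 oQ _ alpha_smooth).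
apply: smooth_mul => //; apply: (smooth_comp2 oQ _ eps_smooth) => //.
by apply: smooth_add => //; exact: Csum.
Qed.

(** [first_variation] on the open set of those [(s, p)] at which the perturbed
    density is still positive, where the integrand is smooth. *)
Lemma jet_first_variation (D U : set spacetime) (L : R -> spacetime -> R)
    (rho ft dr dft : spacetime -> R) (v g dv dg : 'I_d -> spacetime -> R) c r :
  measurable (D : set (measurableTypeR R * 'rV[R]_d)) -> open U ->
  closed_box c r `<=` D -> closed_box c r `<=` U ->
  (forall p, U p -> 0 < rho p) ->
  smooth U rho -> (forall i, smooth U (v i)) -> smooth U ft ->
  (forall i, smooth U (g i)) ->
  smooth U dr -> (forall i, smooth U (dv i)) -> smooth U dft ->
  (forall i, smooth U (dg i)) ->
  (forall s p, closed_box c r p -> L s p =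
    jet_lagrangian (rho p + s * dr p) (fun i => v i p + s * dv i p)
      (ft p + s * dft p) (fun i => g i p + s * dg i p)) ->
  (forall s p, D p -> ~ closed_box c r p -> L s p = L 0 p) ->
  mu.-integrable D (EFin \o L 0) ->
  stationary (fun s => \int[mu]_(p in D) L s p) ->
  \int[mu]_(p in closed_box c r)
    jet_variation (rho p) (v ^~ p) (ft p) (g ^~ p)
      (dr p) (dv ^~ p) (dft p) (dg ^~ p) = 0.
Proof.
move=> mD oU KD KU rho0 Crho Cv Cft Cg Cdr Cdv Cdft Cdg LK Lout iL0 st.
pose pert (f h : spacetime -> R) (z : R * spacetime) := f z.2 + z.1 * h z.2.
pose Q0 := [set z : R * spacetime | U z.2].
have oQ0 : open Q0 by apply: (@open_comp _ _ snd) => // z _; exact: cvg_snd.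
have Cpert f h : smooth U f -> smooth U h -> smooth Q0 (pert f h).
  move=> Cf Ch; apply: smooth_add => //; first exact: smooth_snd.
  apply: smooth_mul => //; [exact: smooth_fst|exact: smooth_snd].
pose Q := Q0 `&` [set z | 0 < pert rho dr z].
have oQ : open Q.
  apply: open_setI_gt0 => // z; apply: smooth_cont; exact: Cpert.
have QQ0 : Q `<=` Q0 by move=> z [].
pose G z := jet_lagrangian (pert rho dr z) (fun i => pert (v i) (dv i) z)
  (pert ft dft z) (fun i => pert (g i) (dg i) z).
have CG : smooth Q G.
  apply: (smooth_jet_lagrangian (v := fun i => pert (v i) (dv i))
    (g := fun i => pert (g i) (dg i)) oQ) => [z []//||i||i];
    apply: smooth_subset QQ0 _; exact: Cpert.
have KQ p : closed_box c r p -> Q (0, p).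
  by move=> /KU Up; split => //=; rewrite /pert mul0r addr0; exact: rho0.
rewrite -[RHS](first_variation mD oQ CG KD KQ LK Lout iL0 st).
apply: eq_Rintegral => p; rewrite inE => /KU Up.
rewrite -derive_jet_lagrangian ?rho0//.
have AE (h : R) : (h *: (1 : R) + 0, p) =
    h *: ((1, 0) : R * spacetime) + (0, p).
  by apply/pair_equal_spec; split => //=; rewrite scaler0 add0r.
exact: (derive_affine G (A := fun s => (s, p)) AE).
Qed.

End jet_lagrangian.

(** * Euler-Lagrange equations *)

Section euler_lagrange.
Context {R : realType} {d : nat}.
Local Notation spacetime := (R * 'rV[R]_d)%type.
Local Notation mu := (@lebesgue_spacetime R d).
Implicit Types (c p q : spacetime) (r s : R).

Lemma material_dtE (u : spacetime -> 'rV[R]_d) (phi : spacetime -> R) p :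
  material_dt u phi p = dt phi p + \sum_i u p ord0 i * dx i phi p.
Proof. by congr (_ + _); apply: eq_bigr => i _; rewrite mxE. Qed.

Lemma mollifier_derive_outside c r v p : 0 < r -> ~ closed_box c r p ->
  'D_v (mollifier c r) p = 0.
Proof.
move=> r0; apply: derive_outside; first exact: closed_box_closed.
by move=> q; exact: mollifier_outside.
Qed.

(** A box inside the interior of the domain keeps the support away from the
    boundary and makes it bounded. *)
Lemma admissible_compact (W : normedModType R) (D : set spacetime)
    (f : spacetime -> W) c r :
  smooth setT f -> closed_box c r `<=` D° ->
  (forall p, ~ closed_box c r p -> f p = 0) -> admissible_variation D f.
Proof.
move=> Cf KD f0; split.
- by exists setT; split => //; exact: openT.
- by move=> p [_ Dp]; apply: f0 => /KD.
- have [M [Mr HM]] := compact_bounded (@closed_box_compact _ _ c r).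
  exists M; split => // x Mx p [_ /= fp]; apply: (HM _ Mx).
  by apply: contrapT => /f0 fp0; rewrite fp0 eqxx in fp.
Qed.

(** The identities below isolate the polynomial arithmetic of the derivation
    from the fields, which appear as plain scalars. *)
Lemma sum_flux (x y w z : 'I_d -> R) g re :
  \sum_j x j - (g * \sum_j y j + re * \sum_j w j) - \sum_j z j =
  \sum_j (x j - (g * y j + re * w j) - z j).
Proof. by rewrite !sumrB big_split/= !mulr_sumr. Qed.

Lemma sum_stress (x y w z : 'I_d -> R) g a :
  \sum_j x j + \sum_j y j + (g * \sum_j z j + a * \sum_j w j) =
  \sum_j (x j + y j + (g * z j + a * w j)).
Proof. by rewrite !mulr_sumr -!big_split. Qed.

Lemma flux_algebra (x y g re uj gj b l : R) :
  x - (y * g + re * uj * gj) - b * l = x - (g * y + re * (uj * gj)) - b * l.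
Proof. by ring. Qed.

Lemma stress_algebra (x z g a gj gjk b dp : R) :
  x + b * dp + (z * g + a * gj * gjk) = x + b * dp + (g * z + a * (gj * gjk)).
Proof. by ring. Qed.

Lemma pressure_algebra (r dr e de a a1 a2 S0 S1 : R) :
  (dr * r + r * dr) * e + r * r * de
  + (2^-1 * (dr * a1 + r * (dr * a2) - dr * a1) * S0
     + 2^-1 * (r * a1 - a) * (2 * S1)) =
  2 * r * dr * e + r * r * de + 2^-1 * (r * (dr * a2)) * S0 + (r * a1 - a) * S1.
Proof. by field. Qed.

Lemma potential_algebra (r dr e de et dpt a1 a2 S0 S1 Su Sgu Sug : R) :
  2^-1 * (2 * Su) - (2^-1 * (dr * a2) * S0 + 2^-1 * a1 * (2 * S1))
  - (dr * e + (dpt + Sgu + Sug) * et) - (dr * e + r * de) =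
  Su - 2^-1 * (dr * a2) * S0 - a1 * S1 - et * (dpt + Sgu + Sug)
  - 2 * dr * e - r * de.
Proof. by field. Qed.

Lemma momentum_algebra (r dr e de et dpt a a1 a2 S0 S1 Su Sgu Sug l g
    T T2 SX SY SZ : R) :
  T + (SX + (2 * r * dr * e + r * r * de + 2^-1 * (r * (dr * a2)) * S0
      + (r * a1 - a) * S1) + (g * SZ + a * S1)) =
  T - (T2 * g + r * et * dpt)
  + (SX - (g * SY + r * et * Sug)
     - ((Su - 2^-1 * (dr * a2) * S0 - a1 * S1 - et * (dpt + Sgu + Sug)
         - 2 * dr * e - r * de) * r + l * dr))
  - (- l * dr - (r * Su - r * et * Sgu)) + g * (T2 + (SY + SZ)).
Proof. by field. Qed.

Section fields.
Variables (alpha : R -> R) (eps : R * R -> R) (t0 t1 : R) (Omega : set 'rV[R]_d).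
Variables (rho phi : spacetime -> R) (u : spacetime -> 'rV[R]_d).
Variable U : set spacetime.
Local Notation D := (cylinder Omega t0 t1).
Hypotheses (oO : open Omega) (oU : open U) (DU : D `<=` U).
Hypothesis alpha_smooth : smooth [set r : R | 0 < r] alpha.
Hypothesis eps_smooth : smooth [set q : R * R | 0 < q.1] eps.
Hypotheses (Crho : smooth U rho) (Cphi : smooth U phi) (Cu : smooth U u).
Hypothesis rho0 : forall p, U p -> 0 < rho p.
Hypothesis iL : mu.-integrable D (EFin \o lagrangian alpha eps rho u phi).

Local Notation ui i := (fun q => u q ord0 i).
Local Notation eta := (fun q => 'D_((0, 1) : R * R) eps (rho q, material_dt u phi q)).
Local Notation eps_rho := (fun q => 'D_((1, 0) : R * R) eps (rho q, material_dt u phi q)).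

Definition interior_cylinder : set spacetime := `]t0, t1[ `*` Omega.
Local Notation I := interior_cylinder.

Lemma open_interior_cylinder : open I.
Proof.
rewrite (_ : I = fst @^-1` `]t0, t1[ `&` snd @^-1` Omega)//.
apply: openI; apply: open_comp => //.
- by move=> p _; exact: cvg_fst.
- by move=> p _; exact: cvg_snd.
Qed.

Lemma interior_cylinderS : I `<=` D.
Proof.
move=> p [/= pt pO]; split => //=; move: pt.
by rewrite !in_itv/= => /andP[? ?]; rewrite !ltW.
Qed.

Lemma measurable_cylinder : measurable (D : set (measurableTypeR R * 'rV[R]_d)).
Proof. by apply: measurableX => //; exact: open_measurable_rV. Qed.

Let IU : I `<=` U := subset_trans interior_cylinderS DU.
Let Cui i : smooth U (ui i). Proof. exact: smooth_coord. Qed.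
Let Cdt (f : spacetime -> R) (V : set spacetime) : smooth V f -> smooth V (dt f).
Proof. exact: smooth_D. Qed.
Let Cdx i (f : spacetime -> R) (V : set spacetime) : smooth V f -> smooth V (dx i f).
Proof. exact: smooth_D. Qed.

Lemma smooth_material_dt : smooth U (material_dt u phi).
Proof.
apply: (smooth_eq oU (f := fun p => dt phi p + \sum_i u p ord0 i * dx i phi p)).
  by move=> p _; rewrite material_dtE.
apply: smooth_add => //; first exact: Cdt.
by apply: smooth_sum => // i; apply: smooth_mul => //; exact: Cdx.
Qed.

Lemma smooth_eps_D v : smooth U (fun q => 'D_v eps (rho q, material_dt u phi q)).
Proof.
apply: (smooth_comp2 oU _ (smooth_D v eps_smooth)) => //.
exact: smooth_material_dt.
Qed.

Lemma smooth_alpha_rho : smooth U (fun q => alpha (rho q)).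
Proof. exact: (smooth_comp1 oU _ alpha_smooth). Qed.

Lemma box_interior c r : closed_box c r `<=` I -> closed_box c r `<=` D°.
Proof.
move=> KI p /KI Ip; rewrite /interior; apply: (filterS interior_cylinderS).
by apply: open_nbhs_nbhs; split => //; exact: open_interior_cylinder.
Qed.

(** Testing with mollifiers, the integrand of the first variation is
    [B0 * dt psi + sum_i B i * dx i psi], with [B0] and [B i] the opposites of
    the density and of the flux of the entropy equation. *)
Lemma euler_lagrange_phi :
  (forall psi, admissible_variation D psi -> stationary (fun s =>
     action alpha eps Omega t0 t1 rho u (fun p => phi p + s * psi p))) ->
  forall p, I p ->
  dt (fun q => rho q * eta q) p +
  \sum_i dx i (fun q => rho q * eta q * u q ord0 i + alpha (rho q) * dx i phi q) p = 0.
Proof.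
move=> st.
pose B0 q := - (rho q * eta q).
pose B i q := - (rho q * eta q * u q ord0 i + alpha (rho q) * dx i phi q).
have Crhoeta : smooth U (fun q => rho q * eta q).
  by apply: smooth_mul => //; exact: smooth_eps_D.
have Cflux i : smooth U (fun q => rho q * eta q * u q ord0 i + alpha (rho q) * dx i phi q).
  apply: smooth_add => //; apply: smooth_mul => //.
    exact: smooth_alpha_rho.
  exact: Cdx.
have oI := open_interior_cylinder.
move=> p Ip.
have -> : dt (fun q => rho q * eta q) p = - dt B0 p.
  by rewrite /dt D_opp ?opprK//; apply: (smooth_diff Crhoeta); exact: IU.
have -> : \sum_i dx i (fun q => rho q * eta q * u q ord0 i
    + alpha (rho q) * dx i phi q) p = - \sum_i dx i (B i) p.
  rewrite -sumrN; apply: eq_bigr => i _; rewrite /dx D_opp ?opprK//.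
  exact: (smooth_diff (Cflux i) (IU Ip)).
rewrite -opprD; apply/eqP; rewrite oppr_eq0; apply/eqP; apply/esym.
apply: (@weak_to_strong _ _ I (fun=> 0) B0 B oI _ _ _ _ p Ip).
- exact: smooth_cst.
- apply: smooth_opp => //; exact: smooth_subset Crhoeta.
- move=> i; apply: smooth_opp => //; exact: smooth_subset (Cflux i).
move=> c r r0 KI.
pose psi := mollifier c r.
have Cpsi : smooth setT psi by exact: smooth_mollifier.
have adm : admissible_variation D psi.
  apply: (@admissible_compact _ _ _ c r) => //; first exact: box_interior.
  by move=> q; exact: mollifier_outside.
have KD := subset_trans KI interior_cylinderS.
have KU := subset_trans KD DU.
have CpsiU : smooth U psi by exact: smooth_subset Cpsi.
pose L s := lagrangian alpha eps rho u (fun p => phi p + s * psi p).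
have LE s q : U q -> L s q = jet_lagrangian alpha eps (rho q + s * 0)
    (fun i => u q ord0 i + s * 0) (dt phi q + s * dt psi q)
    (fun i => dx i phi q + s * dx i psi q).
  move=> Uq; rewrite /L lagrangianE mulr0 addr0.
  have Dv v : 'D_v (fun p => phi p + s * psi p) q = 'D_v phi q + s * 'D_v psi q.
    have [_ ->//] := has_D_add (has_DP v (smooth_diff Cphi Uq))
      (has_D_cmul s (has_DP v (smooth_diff CpsiU Uq))).
  congr (jet_lagrangian _ _ _ _ _ _).
  - by apply/funext => i; rewrite addr0.
  - exact: Dv.
  - by apply/funext => i; exact: Dv.
rewrite -[RHS](@jet_first_variation R d alpha eps alpha_smooth eps_smooth
  D U L rho (dt phi) (fun=> 0) (dt psi) (fun i => ui i) (fun i => dx i phi)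
  (fun i => fun=> 0) (fun i => dx i psi) c r)//.
- apply: eq_Rintegral => q _; rewrite /B0 /B /jet_variation -!material_dtE.
  have -> : \sum_i u q ord0 i * 0 = 0 :> R by rewrite big1// => i; rewrite mulr0.
  have -> : \sum_i - (rho q * eta q * u q ord0 i + alpha (rho q) * dx i phi q)
        * dx i psi q =
      - (rho q * eta q * \sum_i u q ord0 i * dx i psi q)
      - alpha (rho q) * \sum_i dx i phi q * dx i psi q.
    by rewrite !mulr_sumr -!sumrN -big_split/=; apply: eq_bigr => i _; ring.
  have -> : \sum_i (0 * dx i phi q + u q ord0 i * dx i psi q) =
      \sum_i u q ord0 i * dx i psi q.
    by apply: eq_bigr => i _; rewrite mul0r add0r.
  by rewrite /psi; ring.
- exact: measurable_cylinder.
- exact: Cdt.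
- by move=> i; exact: Cdx.
- exact: smooth_cst.
- by move=> i; exact: smooth_cst.
- exact: Cdt.
- by move=> i; exact: Cdx.
- by move=> s q /KU; exact: LE.
- move=> s q /DU Uq Kq; rewrite !LE//; congr jet_lagrangian.
  + by rewrite !mulr0.
  + by apply/funext => i; rewrite !mulr0.
  + by rewrite /dt mollifier_derive_outside// !mulr0.
  + by apply/funext => i; rewrite /dx mollifier_derive_outside// !mulr0.
- rewrite (_ : L 0 = lagrangian alpha eps rho u phi)// /L.
  by congr lagrangian; apply/funext => q; rewrite mul0r addr0.
- exact: st.
Qed.

(** The partial derivative of the Lagrangian with respect to the density. *)
Definition momentum_potential q : R :=
  2^-1 * (\sum_i u q ord0 i * u q ord0 i)
  - 2^-1 * 'D_1 alpha (rho q) * (\sum_i dx i phi q * dx i phi q)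
  - eps (rho q, material_dt u phi q) - rho q * eps_rho q.
Local Notation ell := momentum_potential.

Lemma smooth_momentum_potential : smooth U ell.
Proof.
have C2 : smooth U (fun=> 2^-1 : R) by exact: smooth_cst.
have Ceps : smooth U (fun q => eps (rho q, material_dt u phi q)).
  by apply: (smooth_comp2 oU _ eps_smooth) => //; exact: smooth_material_dt.
have Calpha' : smooth U (fun q => 'D_1 alpha (rho q)).
  by apply: (smooth_comp1 oU _ (smooth_D (1 : R) alpha_smooth)).
have Cu2 : smooth U (fun q => \sum_i u q ord0 i * u q ord0 i).
  by apply: smooth_sum => // i; exact: smooth_mul.
have Cg2 : smooth U (fun q => \sum_i dx i phi q * dx i phi q).
  by apply: smooth_sum => // i; apply: smooth_mul => //; exact: Cdx.
apply: (smooth_sub oU _ (smooth_mul oU Crho (smooth_eps_D (1, 0)))).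
apply: (smooth_sub oU _ Ceps).
apply: (smooth_sub oU (smooth_mul oU C2 Cu2)).
by apply: smooth_mul => //; exact: smooth_mul.
Qed.

Lemma sum_deltal (k : 'I_d) (f : 'I_d -> R) : \sum_i (i == k)%:R * f i = f k.
Proof.
rewrite (bigD1 k)//= eqxx mul1r big1 ?addr0// => i /negbTE ->.
by rewrite mul0r.
Qed.

Section translation.
Variables (k : 'I_d) (psi : spacetime -> R).
Hypothesis Cpsi : smooth U psi.
Local Notation zeta := (fun q => psi q *: delta_mx ord0 k : 'rV[R]_d).

Lemma zetaE i : (fun q => zeta q ord0 i) = (fun q => (i == k)%:R * psi q).
Proof. by apply/funext => q; rewrite !mxE eqxx mulrC. Qed.

Lemma delta_rhoE q : U q ->
  delta_rho rho zeta q = - (dx k rho q * psi q + rho q * dx k psi q).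
Proof.
move=> Uq; congr (- _); have dr := smooth_diff Crho Uq.
have dpsi := smooth_diff Cpsi Uq.
rewrite -(sum_deltal k (fun i => dx i rho q * psi q + rho q * dx i psi q)).
apply: eq_bigr => i _.
rewrite (_ : (fun q => _) = (fun q => (i == k)%:R * (rho q * psi q))).
  by rewrite /dx D_cmul ?D_mul//; exact: differentiableM.
by apply/funext => q'; rewrite !mxE eqxx; ring.
Qed.

Lemma delta_uE q i : U q ->
  delta_u u zeta q ord0 i =
  (i == k)%:R * (dt psi q + \sum_j u q ord0 j * dx j psi q)
  - psi q * dx k (ui i) q.
Proof.
move=> Uq; have dpsi := smooth_diff Cpsi Uq.
rewrite !mxE zetaE /dt D_cmul// mulrDr mulr_sumr; congr (_ + _ - _).
  apply: eq_bigr => j _; rewrite !mxE zetaE /dx D_cmul//; ring.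
rewrite -(sum_deltal k (fun j => psi q * dx j (ui i) q)).
by apply: eq_bigr => j _; rewrite !mxE eqxx/=; ring.
Qed.

End translation.

(** The virtual displacement is a mollifier times the [k]-th basis vector. With
    [m = rho (u - eta grad phi)] the derivative of the Lagrangian in [u], this
    is the [k]-th component of
    [dt m + div (u (x) m) + (du/dx)^T m = rho grad ell], in which
    [rho grad ell] is written [grad (ell rho) - ell grad rho]. *)
Lemma euler_lagrange_motion (k : 'I_d) :
  (forall zeta, admissible_variation D zeta -> stationary (fun s =>
     action alpha eps Omega t0 t1 (fun p => rho p + s * delta_rho rho zeta p)
       (fun p => u p + s *: delta_u u zeta p) phi)) ->
  forall p, I p ->
  - ell p * dx k rho p
  - \sum_i rho p * (u p ord0 i - eta p * dx i phi p) * dx k (ui i) p =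
  dt (fun q => rho q * u q ord0 k - rho q * eta q * dx k phi q) p +
  \sum_j dx j (fun q => rho q * (u q ord0 j * u q ord0 k)
    - rho q * eta q * u q ord0 j * dx k phi q - (j == k)%:R * (ell q * rho q)) p.
Proof.
move=> st p Ip.
pose A q := - ell q * dx k rho q
  - \sum_i rho q * (u q ord0 i - eta q * dx i phi q) * dx k (ui i) q.
pose B0 q := rho q * u q ord0 k - rho q * eta q * dx k phi q.
pose B j q := rho q * (u q ord0 j * u q ord0 k)
    - rho q * eta q * u q ord0 j * dx k phi q - (j == k)%:R * (ell q * rho q).
have Cell := smooth_momentum_potential.
have Ceta := smooth_eps_D (0, 1).
have Crhoeta : smooth U (fun q => rho q * eta q) by exact: smooth_mul.
have Cphi_ j : smooth U (dx j phi) by exact: Cdx.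
have CA : smooth U A.
  apply: smooth_sub => //; first by apply: smooth_mul => //; [exact: smooth_opp|exact: Cdx].
  apply: smooth_sum => // i; apply: smooth_mul => //; last exact: Cdx.
  by apply: smooth_mul => //; apply: smooth_sub => //; exact: smooth_mul.
have CB0 : smooth U B0 by apply: smooth_sub => //; exact: smooth_mul.
have CB j : smooth U (B j).
  apply: smooth_sub => //; last first.
    by apply: smooth_mul => //; [exact: smooth_cst|exact: smooth_mul].
  apply: smooth_sub => //; first by apply: smooth_mul => //; exact: smooth_mul.
  by apply: smooth_mul => //; exact: smooth_mul.
have oI := open_interior_cylinder.
apply: (@weak_to_strong _ _ I A B0 B oI _ _ _ _ p Ip).
- exact: smooth_subset CA.
- exact: smooth_subset CB0.
- by move=> i; exact: smooth_subset (CB i).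
move=> c r r0 KI.
pose psi := mollifier c r.
have Cpsi : smooth setT psi by exact: smooth_mollifier.
have CpsiU : smooth U psi by exact: smooth_subset Cpsi.
pose zeta q : 'rV[R]_d := psi q *: delta_mx ord0 k.
have adm : admissible_variation D zeta.
  apply: (@admissible_compact _ _ _ c r) => //; last 2 first.
  - exact: box_interior.
  - by move=> q Kq; rewrite /zeta /psi mollifier_outside// scale0r.
  by apply: smooth_scalel => //; exact: openT.
have KD := subset_trans KI interior_cylinderS.
have KU := subset_trans KD DU.
pose dr q := - (dx k rho q * psi q + rho q * dx k psi q).
pose dv i q := (i == k)%:R * (dt psi q + \sum_j u q ord0 j * dx j psi q)
  - psi q * dx k (ui i) q.
pose L s := lagrangian alpha eps (fun p => rho p + s * delta_rho rho zeta p)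
  (fun p => u p + s *: delta_u u zeta p) phi.
have LE s q : U q -> L s q = jet_lagrangian alpha eps (rho q + s * dr q)
    (fun i => u q ord0 i + s * dv i q) (dt phi q + s * 0)
    (fun i => dx i phi q + s * 0).
  move=> Uq; rewrite /L lagrangianE mulr0 addr0; congr jet_lagrangian.
  - by rewrite delta_rhoE.
  - by apply/funext => i; rewrite mxE [X in _ + X]mxE delta_uE.
  - by apply/funext => i; rewrite addr0.
rewrite -[RHS](@jet_first_variation R d alpha eps alpha_smooth eps_smooth
  D U L rho (dt phi) dr (fun=> 0) (fun i => ui i) (fun i => dx i phi)
  dv (fun i => fun=> 0) c r)//.
- apply: eq_Rintegral => q _; rewrite /jet_variation -!material_dtE -/(ell q).
  have -> : \sum_i dx i phi q * 0 = 0 :> R by rewrite big1// => i; rewrite mulr0.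
  have dvE (a : 'I_d -> R) : \sum_i a i * dv i q =
      a k * (dt psi q + \sum_j u q ord0 j * dx j psi q)
      - psi q * \sum_i a i * dx k (ui i) q.
    rewrite -(sum_deltal k (fun i => a i * _)) mulr_sumr -sumrB.
    by apply: eq_bigr => i _; rewrite /dv; ring.
  have -> : \sum_i (dv i q * dx i phi q + u q ord0 i * 0) =
      \sum_i dx i phi q * dv i q.
    by apply: eq_bigr => i _; rewrite mulr0 addr0 mulrC.
  rewrite !dvE.
  have -> : A q = - ell q * dx k rho q - (rho q * \sum_i u q ord0 i * dx k (ui i) q
      - rho q * eta q * \sum_i dx i phi q * dx k (ui i) q).
    rewrite /A !mulr_sumr -sumrB; congr (_ - _).
    by apply: eq_bigr => i _; ring.
  have -> : \sum_j B j q * dx j psi q =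
      (rho q * u q ord0 k - rho q * eta q * dx k phi q) *
        (\sum_j u q ord0 j * dx j psi q) - ell q * rho q * dx k psi q.
    rewrite -(sum_deltal k (fun j => ell q * rho q * dx j psi q)).
    by rewrite mulr_sumr -sumrB; apply: eq_bigr => i _; rewrite /B; ring.
  by rewrite /B0 /dr /psi; ring.
- exact: measurable_cylinder.
- exact: Cdt.
- by apply: smooth_opp => //; apply: smooth_add => //; apply: smooth_mul => //; exact: Cdx.
- move=> i; apply: smooth_sub => //; last by apply: smooth_mul => //; exact: Cdx.
  apply: smooth_mul => //; first exact: smooth_cst.
  apply: smooth_add => //; first exact: Cdt.
  by apply: smooth_sum => // j; apply: smooth_mul => //; exact: Cdx.
- exact: smooth_cst.
- by move=> i; exact: smooth_cst.
- by move=> s q /KU; exact: LE.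
- move=> s q /DU Uq Kq; rewrite !LE//; congr jet_lagrangian.
  + by rewrite /dr /psi mollifier_outside// /dx mollifier_derive_outside//; ring.
  + apply/funext => i; rewrite /dv /psi mollifier_outside// /dt /dx.
    rewrite mollifier_derive_outside// big1 => [|j _]; first ring.
    by rewrite mollifier_derive_outside// mulr0.
  + by rewrite !mulr0.
  + by apply/funext => i; rewrite !mulr0.
- rewrite (_ : L 0 = lagrangian alpha eps rho u phi)// /L.
  congr lagrangian; apply/funext => q; first by rewrite mul0r addr0.
  by rewrite scale0r addr0.
- exact: st.
Qed.

(** * Balance of momentum *)

Definition pressure q : R :=
  rho q * rho q * eps_rho q
  + 2^-1 * (rho q * 'D_1 alpha (rho q) - alpha (rho q))
    * \sum_i dx i phi q * dx i phi q.

Definition entropy_residual p : R :=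
  dt (fun q => rho q * eta q) p +
  \sum_i dx i (fun q => rho q * eta q * u q ord0 i
                        + alpha (rho q) * dx i phi q) p.

Definition momentum_residual k p : R :=
  dt (fun q => rho q * u q ord0 k) p +
  \sum_j dx j (fun q => rho q * (u q ord0 j * u q ord0 k)
    + (j == k)%:R * pressure q + alpha (rho q) * dx j phi q * dx k phi q) p.

Lemma has_D_pressure v p : U p ->
  has_D pressure p v
    (2 * rho p * 'D_v rho p * eps_rho p + rho p * rho p * 'D_v eps_rho p
     + 2^-1 * (rho p * ('D_v rho p * 'D_1 ('D_1 alpha) (rho p)))
       * (\sum_i dx i phi p * dx i phi p)
     + (rho p * 'D_1 alpha (rho p) - alpha (rho p))
       * (\sum_i dx i phi p * 'D_v (dx i phi) p)).
Proof.
move=> Up; have h f (Cf : smooth U f) := has_DP v (smooth_diff Cf Up).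
have Da : differentiable alpha (rho p) by exact: (smooth_diff alpha_smooth (rho0 Up)).
have Da' : differentiable ('D_1 alpha) (rho p).
  exact: (smooth_diff (smooth_D (1 : R) alpha_smooth) (rho0 Up)).
have hr := h _ Crho; have he := h _ (smooth_eps_D (1, 0)).
have hg := has_D_sum (fun i => has_D_mul (h _ (Cdx i Cphi)) (h _ (Cdx i Cphi))).
have [dP DP] := has_D_add (has_D_mul (has_D_mul hr hr) he)
  (has_D_mul (has_D_cmul 2^-1 (has_D_sub (has_D_mul hr (has_D_comp1 hr Da'))
    (has_D_comp1 hr Da))) hg).
split => //; rewrite [LHS]DP.
have -> : \sum_i ('D_v (dx i phi) p * dx i phi p + dx i phi p * 'D_v (dx i phi) p)
    = 2 * \sum_i dx i phi p * 'D_v (dx i phi) p.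
  by rewrite mulr_sumr; apply: eq_bigr => i _; ring.
exact: pressure_algebra.
Qed.

Lemma has_D_potential v p : U p ->
  has_D ell p v
    (\sum_i u p ord0 i * 'D_v (ui i) p
     - 2^-1 * ('D_v rho p * 'D_1 ('D_1 alpha) (rho p))
       * (\sum_i dx i phi p * dx i phi p)
     - 'D_1 alpha (rho p) * (\sum_i dx i phi p * 'D_v (dx i phi) p)
     - eta p * ('D_v (dt phi) p + \sum_i dx i phi p * 'D_v (ui i) p
       + \sum_i u p ord0 i * 'D_v (dx i phi) p)
     - 2 * 'D_v rho p * eps_rho p - rho p * 'D_v eps_rho p).
Proof.
move=> Up; have h f (Cf : smooth U f) := has_DP v (smooth_diff Cf Up).
have Da' : differentiable ('D_1 alpha) (rho p).
  exact: (smooth_diff (smooth_D (1 : R) alpha_smooth) (rho0 Up)).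
have Deps : differentiable eps (rho p, material_dt u phi p).
  by apply: (smooth_diff eps_smooth) => /=; exact: rho0.
have hr := h _ Crho; have he := h _ (smooth_eps_D (1, 0)).
have hg := has_D_sum (fun i => has_D_mul (h _ (Cdx i Cphi)) (h _ (Cdx i Cphi))).
have hu := has_D_sum (fun i => has_D_mul (h _ (Cui i)) (h _ (Cui i))).
have hm := h _ smooth_material_dt.
have [dP DP] := has_D_sub (has_D_sub (has_D_sub (has_D_cmul 2^-1 hu)
  (has_D_mul (has_D_cmul 2^-1 (has_D_comp1 hr Da')) hg))
  (has_D_comp2 hr hm Deps)) (has_D_mul hr he).
split => //; rewrite [LHS]DP.
have -> : 'D_v (material_dt u phi) p = 'D_v (dt phi) p
    + \sum_i dx i phi p * 'D_v (ui i) p + \sum_i u p ord0 i * 'D_v (dx i phi) p.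
  have [_] := has_D_add (h _ (Cdt Cphi)) (has_D_sum (fun i =>
    has_D_mul (h _ (Cui i)) (h _ (Cdx i Cphi)))).
  rewrite (_ : (fun y => _) = material_dt u phi); last first.
    by apply/funext => q; rewrite material_dtE.
  by move=> ->; rewrite big_split/= addrA; congr (_ + _ + _);
    apply: eq_bigr => i _; rewrite mulrC.
have -> : \sum_i ('D_v (dx i phi) p * dx i phi p + dx i phi p * 'D_v (dx i phi) p)
    = 2 * \sum_i dx i phi p * 'D_v (dx i phi) p.
  by rewrite mulr_sumr; apply: eq_bigr => i _; ring.
have -> : \sum_i ('D_v (ui i) p * u p ord0 i + u p ord0 i * 'D_v (ui i) p)
    = 2 * \sum_i u p ord0 i * 'D_v (ui i) p.
  by rewrite mulr_sumr; apply: eq_bigr => i _; ring.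
exact: potential_algebra.
Qed.

Lemma smooth_entropy_residual : smooth U entropy_residual.
Proof.
have Crhoeta : smooth U (fun q => rho q * eta q).
  by apply: smooth_mul => //; exact: smooth_eps_D.
apply: smooth_add => //; first exact: Cdt.
apply: smooth_sum => // i; apply: Cdx; apply: smooth_add => //.
  exact: smooth_mul.
by apply: smooth_mul => //; [exact: smooth_alpha_rho|exact: Cdx].
Qed.

Lemma smooth_pressure : smooth U pressure.
Proof.
have Crho' : smooth U (fun q => 'D_1 alpha (rho q)).
  by apply: (smooth_comp1 oU _ (smooth_D (1 : R) alpha_smooth)).
apply: smooth_add => //; apply: smooth_mul => //.
- exact: smooth_mul.
- exact: smooth_eps_D.
- apply: smooth_mul => //; first exact: smooth_cst.
  by apply: smooth_sub => //; [exact: smooth_mul|exact: smooth_alpha_rho].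
- by apply: smooth_sum => // i; apply: smooth_mul => //; exact: Cdx.
Qed.

Lemma smooth_momentum_residual k : smooth U (momentum_residual k).
Proof.
apply: smooth_add => //; first by apply: Cdt; exact: smooth_mul.
apply: smooth_sum => // j; apply: Cdx; apply: smooth_add => //.
  apply: smooth_add => //; apply: smooth_mul => //; first exact: smooth_mul.
    exact: smooth_cst.
  exact: smooth_pressure.
apply: smooth_mul => //; last exact: Cdx.
by apply: smooth_mul => //; [exact: smooth_alpha_rho|exact: Cdx].
Qed.

(** The part [- rho eta grad phi] of the momentum [m] contributes the transport
    of the entropy, which the entropy equation replaces by
    [div (alpha grad phi) grad phi], and the transport of [grad phi], which
    combines with [(du/dx)^T grad phi] into the gradient of the material
    derivative of [phi] because second derivatives commute. The remaining
    terms are the gradient of the pressure and the stress of [grad phi]. *)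
Lemma momentum_from_euler_lagrange k p : U p ->
  entropy_residual p = 0 ->
  - ell p * dx k rho p
  - \sum_i rho p * (u p ord0 i - eta p * dx i phi p) * dx k (ui i) p =
  dt (fun q => rho q * u q ord0 k - rho q * eta q * dx k phi q) p +
  \sum_j dx j (fun q => rho q * (u q ord0 j * u q ord0 k)
    - rho q * eta q * u q ord0 j * dx k phi q - (j == k)%:R * (ell q * rho q)) p ->
  momentum_residual k p = 0.
Proof.
move=> Up E1 E2; have h f v (Cf : smooth U f) := has_DP v (smooth_diff Cf Up).
have Cell := smooth_momentum_potential.
have Cre : smooth U (fun q => rho q * eta q).
  by apply: smooth_mul => //; exact: smooth_eps_D.
have Creu j : smooth U (fun q => rho q * eta q * u q ord0 j) by exact: smooth_mul.
have Cag j : smooth U (fun q => alpha (rho q) * dx j phi q).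
  by apply: smooth_mul => //; [exact: smooth_alpha_rho|exact: Cdx].
have Cruu j : smooth U (fun q => rho q * (u q ord0 j * u q ord0 k)).
  by apply: smooth_mul => //; exact: smooth_mul.
have Cru : smooth U (fun q => rho q * u q ord0 k) by exact: smooth_mul.
have Ck_ := Cdx k Cphi.
have Clr : smooth U (fun q => ell q * rho q) by exact: smooth_mul.
have commt : dt (dx k phi) p = dx k (dt phi) p by exact: derive_comm oU Cphi Up.
have commx j : dx j (dx k phi) p = dx k (dx j phi) p.
  exact: derive_comm oU Cphi Up.
pose X j := dx j (fun q => rho q * (u q ord0 j * u q ord0 k)) p.
pose Y j := dx j (fun q => rho q * eta q * u q ord0 j) p.
pose Z j := dx j (fun q => alpha (rho q) * dx j phi q) p.
have E1' : dt (fun q => rho q * eta q) p + (\sum_j Y j + \sum_j Z j) = 0.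
  rewrite -[RHS]E1 /entropy_residual -big_split/=; congr (_ + _).
  apply: eq_bigr => j _.
  have [_ DE] := has_D_add (h _ (0, delta_mx ord0 j) (Creu j))
    (h _ (0, delta_mx ord0 j) (Cag j)).
  exact/esym/DE.
have dtE : dt (fun q => rho q * u q ord0 k - rho q * eta q * dx k phi q) p =
    dt (fun q => rho q * u q ord0 k) p
    - (dt (fun q => rho q * eta q) p * dx k phi p
       + rho p * eta p * dx k (dt phi) p).
  have [_ DE] := has_D_sub (h _ (1, 0) Cru) (has_D_mul (h _ (1, 0) Cre) (h _ (1, 0) Ck_)).
  by rewrite -commt; exact: DE.
have sumE : \sum_j dx j (fun q => rho q * (u q ord0 j * u q ord0 k)
      - rho q * eta q * u q ord0 j * dx k phi q - (j == k)%:R * (ell q * rho q)) p =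
    \sum_j X j - (dx k phi p * \sum_j Y j
      + rho p * eta p * \sum_j u p ord0 j * dx k (dx j phi) p)
    - dx k (fun q => ell q * rho q) p.
  rewrite -(sum_deltal k (fun j => dx j (fun q => ell q * rho q) p)).
  rewrite sum_flux; apply: eq_bigr => j _.
  have [_ DE] := has_D_sub (has_D_sub (h _ (0, delta_mx ord0 j) (Cruu j))
    (has_D_mul (h _ (0, delta_mx ord0 j) (Creu j)) (h _ (0, delta_mx ord0 j) Ck_)))
    (has_D_cmul (j == k)%:R (h _ (0, delta_mx ord0 j) Clr)).
  rewrite -commx; apply: (etrans DE).
  by rewrite -/(dx j (dx k phi) p) -/(X j) -/(Y j); exact: flux_algebra.
have lhsE : \sum_i rho p * (u p ord0 i - eta p * dx i phi p) * dx k (ui i) p =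
    rho p * \sum_i u p ord0 i * dx k (ui i) p
    - rho p * eta p * \sum_i dx i phi p * dx k (ui i) p.
  by rewrite !mulr_sumr -sumrB; apply: eq_bigr => i _; ring.
have goalE : momentum_residual k p = dt (fun q => rho q * u q ord0 k) p
    + (\sum_j X j + dx k pressure p + (dx k phi p * \sum_j Z j
      + alpha (rho p) * \sum_j dx j phi p * dx k (dx j phi) p)).
  rewrite /momentum_residual -(sum_deltal k (fun j => dx j pressure p)).
  rewrite sum_stress; congr (_ + _); apply: eq_bigr => j _.
  have [_ DE] := has_D_add (has_D_add (h _ (0, delta_mx ord0 j) (Cruu j))
    (has_D_cmul (j == k)%:R (has_D_pressure (0, delta_mx ord0 j) Up)))
    (has_D_mul (h _ (0, delta_mx ord0 j) (Cag j)) (h _ (0, delta_mx ord0 j) Ck_)).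
  have [_ DP] := has_D_pressure (0, delta_mx ord0 j) Up.
  rewrite -commx; apply: (etrans DE); rewrite -DP.
  by rewrite -/(dx j (dx k phi) p) -/(X j) -/(Z j); exact: stress_algebra.
have [_ Dell] := has_D_mul (has_D_potential (0, delta_mx ord0 k) Up)
  (h _ (0, delta_mx ord0 k) Crho).
have [_ DP] := has_D_pressure (0, delta_mx ord0 k) Up.
have sym : momentum_residual k p =
    (dt (fun q => rho q * u q ord0 k - rho q * eta q * dx k phi q) p +
    \sum_j dx j (fun q => rho q * (u q ord0 j * u q ord0 k)
    - rho q * eta q * u q ord0 j * dx k phi q - (j == k)%:R * (ell q * rho q)) p)
    - (- ell p * dx k rho p
  - \sum_i rho p * (u p ord0 i - eta p * dx i phi p) * dx k (ui i) p)
  + dx k phi p * (dt (fun q => rho q * eta q) p + (\sum_j Y j + \sum_j Z j)).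
  rewrite goalE dtE sumE lhsE [dx k pressure p]DP [dx k (fun q => ell q * rho q) p]Dell.
  exact: momentum_algebra.
by rewrite sym E1' E2 subrr mulr0 addr0.
Qed.

End fields.
End euler_lagrange.

(** * The conservation laws *)

Section closing.
Context {R : realType} {d : nat}.
Local Notation spacetime := (R * 'rV[R]_d)%type.

(** A point at an extreme time is the limit of points moved slightly towards the
    middle of the time interval. *)
Lemma zero_on_cylinder (t0 t1 : R) (Omega : set 'rV[R]_d) (U : set spacetime)
    (H : spacetime -> R) :
  t0 < t1 -> cylinder Omega t0 t1 `<=` U ->
  (forall p, U p -> {for p, continuous H}) ->
  (forall p, interior_cylinder t0 t1 Omega p -> H p = 0) ->
  forall p, cylinder Omega t0 t1 p -> H p = 0.
Proof.
move=> t01 DU cH H0 [t x] Dp; have [/= tt xO] := Dp.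
apply/eqP; rewrite -normr_eq0 eq_le normr_ge0 andbT leNgt; apply/negP => Hp.
have /cvgrPdist_lt/(_ _ Hp)/nbhs_ballP[e /= e0 eH] :
  H q @[q --> (t, x)] --> H (t, x) := cH _ (DU _ Dp).
(* The fraction of the way to the midpoint that stays within distance [e]. *)
pose k := Num.min 1 (e / (2 * (t1 - t0))).
have k0 : 0 < k by rewrite lt_min ltr01 divr_gt0// mulr_gt0// subr_gt0.
have k1 : k <= 1 by rewrite ge_min lexx.
have ke : k * (t1 - t0) < e.
  apply: (@le_lt_trans _ _ (e / (2 * (t1 - t0)) * (t1 - t0))).
    apply: ler_wpM2r; first by rewrite subr_ge0 ltW.
    by rewrite /k ge_min lexx orbT.
  have n0 : t1 - t0 != 0 by rewrite subr_eq0 gt_eqF.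
  rewrite (_ : _ * _ = e / 2); last by field.
  lra.
move: tt; rewrite in_itv/= => /andP[tt0 tt1].
pose t' := t + k * ((t0 + t1) / 2 - t).
have Ip : interior_cylinder t0 t1 Omega (t', x).
  split => //=; rewrite in_itv/= /t'; apply/andP; split; nra.
have : ball (t, x) e (t', x).
  split; last exact: ballxx.
  rewrite /ball/= /t' opprD addNKr normrN normrM gtr0_norm//.
  apply: le_lt_trans ke; apply: ler_wpM2l; first exact: ltW.
  by rewrite ler_norml; apply/andP; split; lra.
by move=> /eH /=; rewrite (H0 _ Ip) subr0 ltxx.
Qed.

End closing.

Theorem mainTheorem1 (R : realType) (d : nat) (d_gt0 : (0 < d)%N)
    (t0 t1 : R) (t0_lt_t1 : t0 < t1)
    (Omega : set 'rV[R]_d) (Omega_open : open Omega)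
    (alpha : R -> R) (eps : R * R -> R)
    (alpha_gt0 : forall r : R, 0 < r -> 0 < alpha r)
    (alpha_smooth : smooth_on [set r : R | 0 < r] alpha)
    (eps_smooth : smooth_on [set q : R * R | 0 < q.1] eps)
    (rho phi : R * 'rV[R]_d -> R) (u : R * 'rV[R]_d -> 'rV[R]_d)
    (rho_smooth : smooth_on (cylinder Omega t0 t1) rho)
    (phi_smooth : smooth_on (cylinder Omega t0 t1) phi)
    (u_smooth : smooth_on (cylinder Omega t0 t1) u)
    (rho_gt0 : forall p, cylinder Omega t0 t1 p -> 0 < rho p)
    (mass : forall p, cylinder Omega t0 t1 p ->
       dt rho p + div (fun q => rho q *: u q) p = 0)
    (action_finite : lebesgue_spacetime.-integrable (cylinder Omega t0 t1)
       (EFin \o lagrangian alpha eps rho u phi))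
    (stationary_phi : forall psi : R * 'rV[R]_d -> R,
       admissible_variation (cylinder Omega t0 t1) psi ->
       stationary (fun s => action alpha eps Omega t0 t1
         rho u (fun p => phi p + s * psi p)))
    (stationary_motion : forall zeta : R * 'rV[R]_d -> 'rV[R]_d,
       admissible_variation (cylinder Omega t0 t1) zeta ->
       stationary (fun s => action alpha eps Omega t0 t1
         (fun p => rho p + s * delta_rho rho zeta p)
         (fun p => u p + s *: delta_u u zeta p)
         phi)) :
  let eta p : R := 'D_((0, 1) : R * R) eps (rho p, material_dt u phi p) in
  let eps_rho p : R := 'D_((1, 0) : R * R) eps (rho p, material_dt u phi p) in
  forall p, cylinder Omega t0 t1 p ->
    dt (fun q => rho q * eta q) p
    + div (fun q => (rho q * eta q) *: u q + alpha (rho q) *: grad phi q) p = 0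
    /\
    dtv (fun q => rho q *: u q) p
    + divT (fun q =>
        rho q *: tens (u q) (u q)
        + (rho q ^+ 2 * eps_rho q
           + 2^-1 * (rho q * derive1 alpha (rho q) - alpha (rho q))
             * dotv (grad phi q) (grad phi q))%:M
        + alpha (rho q) *: tens (grad phi q) (grad phi q)) p = 0.
Proof.
move=> eta eps_rho.
have [Ua [oUa sUa Ca]] := alpha_smooth; have [Ue [oUe sUe Ce]] := eps_smooth.
have {}Ca : smooth [set r : R | 0 < r] alpha by move=> k; apply: Ck_subset (Ca k).
have {}Ce : smooth [set q : R * R | 0 < q.1] eps by move=> k; apply: Ck_subset (Ce k).
have [Ur [oUr sUr Cr]] := rho_smooth; have [Uf [oUf sUf Cf]] := phi_smooth.
have [Uu [oUu sUu Cu]] := u_smooth.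
pose U := (Ur `&` Uf `&` Uu) `&` [set p | 0 < rho p].
have oU : open U.
  apply: open_setI_gt0; first by apply: openI => //; exact: openI.
  by move=> p [[Up _] _]; exact: (Cr 0%N).
have DU : cylinder Omega t0 t1 `<=` U.
  by move=> p Dp; split; [split; [split; [exact: sUr|exact: sUf]|exact: sUu]|exact: rho_gt0].
have {}Cr : smooth U rho by move=> k; apply: Ck_subset (Cr k) => p [[[]]].
have {}Cf : smooth U phi by move=> k; apply: Ck_subset (Cf k) => p [[[]]].
have {}Cu : smooth U u by move=> k; apply: Ck_subset (Cu k) => p [[]].
have r0 p : U p -> 0 < rho p by case.
have E1 p : interior_cylinder t0 t1 Omega p -> entropy_residual alpha eps rho phi u p = 0.
  exact: (euler_lagrange_phi Omega_open oU DU Ca Ce Cr Cf Cu r0 action_finite stationary_phi).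
have E2 k p : interior_cylinder t0 t1 Omega p -> momentum_residual alpha eps rho phi u k p = 0.
  move=> Ip; apply: (momentum_from_euler_lagrange oU Ca Ce Cr Cf Cu r0).
  - exact/DU/interior_cylinderS.
  - exact: E1.
  - by apply: (euler_lagrange_motion Omega_open oU DU Ca Ce Cr Cf Cu r0 action_finite k).
have C1 : smooth U (entropy_residual alpha eps rho phi u).
  exact: smooth_entropy_residual.
have C2 k : smooth U (momentum_residual alpha eps rho phi u k).
  exact: smooth_momentum_residual.
move=> p Dp; split.
  rewrite -[RHS](zero_on_cylinder t0_lt_t1 DU (fun q => @smooth_cont _ _ U _ _ q C1) E1 Dp).
  congr (_ + _); apply: eq_bigr => i _; congr (dx i _ p).
  by apply/funext => q; rewrite !mxE.
apply/rowP => k.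
rewrite [RHS]mxE.
rewrite -[RHS](zero_on_cylinder t0_lt_t1 DU (fun q => @smooth_cont _ _ U _ _ q (C2 k)) (E2 k) Dp).
rewrite mxE [X in X + _]mxE [X in _ + X]mxE; congr (_ + _).
  by congr (dt _ p); apply/funext => q; rewrite mxE.
apply: eq_bigr => j _; congr (dx j _ p); apply/funext => q.
rewrite !mxE; congr (_ + _ + _); last by rewrite mulrA.
rewrite /pressure derive1E expr2 mulr_natl /dotv; congr ((_ + _ * _) *+ _).
by apply: eq_bigr => i _; rewrite !mxE.
Qed.
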